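(* Let $n\geq 2$ and $m\geq 3$ be integers with $(n,m)\neq(2,3)$, and let $f\in\mathbb{C}[x_1,\ldots,x_n]\subset\mathcal{O}_n$ be a regular homogeneous polynomial of degree $m$. Then $f$ is $n(m-2)$-determined. As a consequence, $D(n,m)\leq n(m-2)+1$, and $D(n,m)=m+1$ if $(n,m)=(3,3)$ or $(n,m)=(2,4)$.
   Context: $\mathcal{O}_n=\mathbb{C}\{x_1,\ldots,x_n\}$ is the ring of convergent power series, with maximal ideal $\mathfrak{m}$. A homogeneous polynomial $f\in\mathbb{C}[x_1,\ldots,x_n]$ of degree $m$ is called regular if the hypersurface $\{f=0\}\subset\mathbb{P}^{n-1}$ is smooth (equivalently, the only common zero in $\mathbb{C}^n$ of its partial derivatives is the origin). For $f,g\in\mathcal{O}_n$ write $f\sim g$ (right equivalence) if there is a $\mathbb{C}$-algebra automorphism $\phi$ of $\mathcal{O}_n$ with $\phi(f)=g$. For an integer $k\geq 0$, $f\in\mathcal{O}_n$ is $k$-determined if every $g\in\mathcal{O}_n$ with $g\equiv f \pmod{\mathfrak{m}^{k+1}}$ satisfies $f\sim g$. $D(n,m)$ denotes the smallest integer $D>m$ with the following property: for every regular homogeneous polynomial $f\in\mathbb{C}[x_1,\ldots,x_n]$ of degree $m$, every $d\geq D$, and every $g\in\mathcal{O}_n$ with $g-f\in\mathfrak{m}^d$, the germ at the origin of $\{g=0\}$ is analytically equivalent to the germ at the origin of $\{f=0\}$, i.e. there is a $\mathbb{C}$-algebra automorphism $\phi$ of $\mathcal{O}_n$ and a unit $u\in\mathcal{O}_n$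 with $\phi(f)=u\,g$. *)

(* Defs.v *)
From HB Require Import structures.
From mathcomp Require Import all_boot all_order all_algebra.
From mathcomp Require Import boolp functions reals.
From mathcomp Require Import complex.
From mathcomp Require Import mpoly.

Set Implicit Arguments.
Unset Strict Implicit.
Unset Printing Implicit Defensive.

Import Order.TTheory GRing.Theory Num.Theory.
Local Open Scope ring_scope.

(* A power series in n variables is the family of its coefficients.  It is    *)
(* convergent when it converges absolutely on some polydisc of radii (r,..,r),*)
(* i.e. when the sums of the nonnegative family |a_m| r^|m| are bounded.      *)
Definition convergent (K : numFieldType) (n : nat) (a : 'X_{1..n} -> K) : Prop :=
  exists r : K, exists M : K, 0 < r /\
    forall N : nat, \sum_(m : 'X_{1..n < N}) `|a m| * r ^+ mdeg m <= M.

Definition ps_mul (K : numFieldType) (n : nat) (a b : 'X_{1..n} -> K) :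
    'X_{1..n} -> K :=
  fun m => \sum_(k : 'X_{1..n < (mdeg m).+1, (mdeg m).+1} | m == (k.1 + k.2)%MM)
             a k.1 * b k.2.

Definition ps_one (K : numFieldType) (n : nat) : 'X_{1..n} -> K :=
  fun m => (m == 0%MM)%:R.

Section ConvergentTheory.
Variables (K : numFieldType) (n : nat).
Implicit Types (a b c : 'X_{1..n} -> K) (m : 'X_{1..n}).

Lemma convergentW a (r r' M : K) : 0 < r' -> r' <= r ->
  (forall N : nat, \sum_(m : 'X_{1..n < N}) `|a m| * r ^+ mdeg m <= M) ->
  forall N : nat, \sum_(m : 'X_{1..n < N}) `|a m| * r' ^+ mdeg m <= M.
Proof.
move=> r'0 r'r h N; apply: le_trans (h N); apply: ler_sum => m _.
by apply: ler_wpM2l => //; apply: lerXn2r => //; rewrite nnegrE ltW //;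
  apply: lt_le_trans r'r.
Qed.

Lemma convergent2 a b : convergent a -> convergent b ->
  exists r : K, exists Ma : K, exists Mb : K, [/\ 0 < r,
    forall N : nat, \sum_(m : 'X_{1..n < N}) `|a m| * r ^+ mdeg m <= Ma &
    forall N : nat, \sum_(m : 'X_{1..n < N}) `|b m| * r ^+ mdeg m <= Mb].
Proof.
move=> [r [Ma [r0 ha]]] [s [Mb [s0 hb]]].
case: (@real_leP _ r s); rewrite ?gtr0_real// => rs.
  by exists r, Ma, Mb; split=> //; apply: convergentW hb.
by exists s, Ma, Mb; split=> //; apply: convergentW ha => //; apply: ltW.
Qed.

Lemma convergent_lin (k : K) a b : convergent a -> convergent b ->
  convergent (fun m => k * a m + b m).
Proof.
move=> ca cb; have [r [Ma [Mb [r0 ha hb]]]] := convergent2 ca cb.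
exists r, (`|k| * Ma + Mb); split=> // N.
apply: le_trans (lerD (ler_wpM2l (normr_ge0 k) (ha N)) (hb N)).
rewrite mulr_sumr -big_split /=; apply: ler_sum => m _.
rewrite mulrA -mulrDl; apply: ler_wpM2r; first by rewrite exprn_ge0 // ltW.
by apply: le_trans (ler_normD _ _) _; rewrite normrM.
Qed.

Lemma convergent0 : convergent (0 : 'X_{1..n} -> K).
Proof.
exists 1, 0; split=> // N.
by rewrite big1 // => m _; rewrite normr0 mul0r.
Qed.

Definition convergentb : {pred ('X_{1..n} -> K)} := fun a => `[< convergent a >].

Lemma convergent_zmod : zmod_closed convergentb.
Proof.
split; first exact/asboolP/convergent0.
move=> a b /asboolP ca /asboolP cb; apply/asboolP.
have := convergent_lin (-1) cb ca.
by congr (convergent _); apply/funext => m; rewrite mulN1r addrC.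
Qed.

Definition trunc N a : {mpoly K[n]} := \sum_(m : 'X_{1..n < N}) a m *: 'X_[m].

Lemma trunc_coef N a m : (mdeg m < N)%N -> (trunc N a)@_m = a m.
Proof. exact: mcoeff_mpoly. Qed.

Lemma ps_mul_trunc N a b m : (mdeg m < N)%N ->
  ps_mul a b m = (trunc N a * trunc N b)@_m.
Proof.
move=> mN; rewrite mcoeffM /ps_mul; apply: eq_bigr => k _.
by rewrite !trunc_coef //; apply: leq_trans (bmdeg _) mN.
Qed.

Lemma ps_mul_widen N a b m : (mdeg m < N)%N -> ps_mul a b m =
  \sum_(k : 'X_{1..n < N, N} | m == (k.1 + k.2)%MM) a k.1 * b k.2.
Proof.
move=> mN; rewrite (ps_mul_trunc _ _ mN).
rewrite [LHS](mcoeff_poly_mul _ _ mN).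
by apply: eq_bigr => k _; rewrite !trunc_coef ?bmdeg.
Qed.

Lemma mcoeffM_eq (p p' q q' : {mpoly K[n]}) m :
  (forall k, (mdeg k <= mdeg m)%N -> p@_k = p'@_k) ->
  (forall k, (mdeg k <= mdeg m)%N -> q@_k = q'@_k) ->
  (p * q)@_m = (p' * q')@_m.
Proof.
move=> hp hq; rewrite !mcoeffM; apply: eq_bigr => k _.
by rewrite hp ?hq // -ltnS bmdeg.
Qed.

Lemma ps_mulA : associative (@ps_mul K n).
Proof.
move=> a b c; apply/funext => m; set N := (mdeg m).+1.
have mN : (mdeg m < N)%N by [].
transitivity ((trunc N a * (trunc N b * trunc N c))@_m).
  rewrite (ps_mul_trunc _ _ mN); apply: mcoeffM_eq => // k km.
  by rewrite trunc_coef // (ps_mul_trunc (N := N)).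
rewrite mulrA (ps_mul_trunc _ _ mN); apply: mcoeffM_eq => // k km.
by rewrite trunc_coef // (ps_mul_trunc (N := N)).
Qed.

Lemma ps_mulC : commutative (@ps_mul K n).
Proof.
by move=> a b; apply/funext => m; rewrite !(ps_mul_trunc (N := (mdeg m).+1)) //
  mulrC.
Qed.

Lemma ps_mul1 : left_id (@ps_one K n) (@ps_mul K n).
Proof.
move=> a; apply/funext => m; have mN : (mdeg m < (mdeg m).+1)%N by [].
rewrite (ps_mul_trunc _ _ mN) -[RHS](trunc_coef a mN) -[in RHS](mul1r (trunc _ a)).
by apply: mcoeffM_eq => // k km; rewrite trunc_coef // mcoeff1.
Qed.

Lemma ps_mulDl : left_distributive (@ps_mul K n) +%R.
Proof.
move=> a b c; apply/funext => m; rewrite /ps_mul.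
rewrite /GRing.add/= -big_split /=.
by apply: eq_bigr => k _; rewrite -mulrDl.
Qed.

Lemma ps_mulZl (k : K) a b :
  ps_mul (fun m => k * a m) b = (fun m => k * ps_mul a b m).
Proof.
apply/funext => m; rewrite /ps_mul mulr_sumr.
by apply: eq_bigr => j _; rewrite mulrA.
Qed.

Lemma ps_one_neq0 : @ps_one K n != 0.
Proof.
apply/eqP => /(congr1 (fun a => a 0%MM)); rewrite /ps_one eqxx /= => /eqP.
by rewrite oner_eq0.
Qed.

Lemma convergent_one : convergent (@ps_one K n).
Proof.
exists 1, 1; split=> // N; case: N => [|N].
  by rewrite big1 // => -[m hm]; exfalso.
rewrite (bigD1 (bm0 : 'X_{1..n < N.+1})) //= /ps_one eqxx normr1 mul1r.
rewrite expr1n big1 ?addr0 // => m; rewrite bmeqP /= => /negPf ->.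
by rewrite normr0 mul0r.
Qed.

Lemma convergent_mul a b : convergent a -> convergent b -> convergent (ps_mul a b).
Proof.
move=> ca cb; have [r [Ma [Mb [r0 ha hb]]]] := convergent2 ca cb.
exists r, (Ma * Mb); split=> // N.
pose F (c : 'X_{1..n} -> K) m := `|c m| * r ^+ mdeg m.
have F0 c m : 0 <= F c m by rewrite mulr_ge0 // exprn_ge0 // ltW.
have S0 c (J : nat) : 0 <= \sum_(m : 'X_{1..n < J}) F c m.
  by apply: sumr_ge0 => m _; apply: F0.
apply: le_trans (ler_pM (S0 _ _) (S0 _ _) (ha N) (hb N)).
rewrite big_distrlr /= pair_big /=.
apply: (@le_trans _ _ (\sum_(m : 'X_{1..n < N})
    \sum_(k : 'X_{1..n < N, N} | (m : 'X_{1..n}) == (k.1 + k.2)%MM)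
      F a k.1 * F b k.2)).
  apply: ler_sum => m _; rewrite (ps_mul_widen _ _ (bmdeg m)).
  apply: le_trans (ler_wpM2r _ (ler_norm_sum _ _ _)) _.
    by rewrite exprn_ge0 // ltW.
  rewrite mulr_suml; apply: ler_sum => k /eqP ->.
  by rewrite mdegD exprD normrM mulrACA.
rewrite (exchange_big_dep predT) //=; apply: ler_sum => k _.
case: (pickP (fun m : 'X_{1..n < N} => (m : 'X_{1..n}) == (k.1 + k.2)%MM)).
  move=> m0 h0; rewrite (big_pred1 m0) // => m /=.
  by rewrite bmeqP (eqP h0).
by move=> h; rewrite big_pred0 //; apply: mulr_ge0; apply: F0.
Qed.

Lemma convergent_mpoly (p : {mpoly K[n]}) : convergent (fun m => p@_m).
Proof.
elim/mpolyind: p => [|c m p _ _ cp].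
  by have := convergent0; congr convergent; apply/funext => m; rewrite mcoeff0.
have cX : convergent (fun k => ('X_[m] : {mpoly K[n]})@_k).
  exists 1, 1; split=> // N; under eq_bigr do rewrite expr1n mulr1 mcoeffX.
  have [mN|mN] := ltnP (mdeg m) N.
    rewrite (bigD1 (BMultinom mN)) //= eqxx normr1 big1 ?addr0 // => k.
    by rewrite bmeqP /= eq_sym => /negPf ->; rewrite normr0.
  rewrite big1 // => k _; case: eqP => [mk|_]; last by rewrite normr0.
  by have := bmdeg k; rewrite -mk ltnNge mN.
have := convergent_lin c cX cp; congr convergent.
by apply/funext => k; rewrite mcoeffD mcoeffZ.
Qed.

End ConvergentTheory.

(* The ring K{x_1,...,x_n} of convergent power series. *)
Record convps (K : numFieldType) (n : nat) := ConvPS {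
  pscoef : 'X_{1..n} -> K;
  _ : pscoef \in @convergentb K n
}.

Section ConvPSAlgebra.
Variables (K : numFieldType) (n : nat).
Local Notation O := (convps K n).
Implicit Types f g h : O.

HB.instance Definition _ :=
  GRing.isZmodClosed.Build ('X_{1..n} -> K) (@convergentb K n)
    (@convergent_zmod K n).
HB.instance Definition _ := [isSub for @pscoef K n].
HB.instance Definition _ := [Choice of O by <:].
HB.instance Definition _ := [SubChoice_isSubZmodule of O by <:].

Lemma pscoef_conv f : convergent (pscoef f).
Proof. exact/asboolP/(valP f). Qed.

Definition mkps a (ca : convergent a) : O := ConvPS (introT (asboolP _) ca).

Lemma pscoef_inj : injective (@pscoef K n).
Proof. exact: val_inj. Qed.

Definition convps_one : O := mkps (@convergent_one K n).
Definition convps_mul f g : O :=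
  mkps (convergent_mul (pscoef_conv f) (pscoef_conv g)).

Fact convps_mulA : associative convps_mul.
Proof. by move=> f g h; apply: pscoef_inj; apply: ps_mulA. Qed.
Fact convps_mulC : commutative convps_mul.
Proof. by move=> f g; apply: pscoef_inj; apply: ps_mulC. Qed.
Fact convps_mul1 : left_id convps_one convps_mul.
Proof. by move=> f; apply: pscoef_inj; apply: ps_mul1. Qed.
Fact convps_mulDl : left_distributive convps_mul +%R.
Proof. by move=> f g h; apply: pscoef_inj; apply: ps_mulDl. Qed.
Fact convps_one_neq0 : convps_one != 0.
Proof.
by apply/eqP => /(congr1 (@pscoef K n)) /eqP; rewrite (negPf (ps_one_neq0 K n)).
Qed.

HB.instance Definition _ := GRing.Zmodule_isComNzRing.Build O
  convps_mulA convps_mulC convps_mul1 convps_mulDl convps_one_neq0.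

Fact convergent_scale (k : K) f : convergent (fun m => k * pscoef f m).
Proof.
have := convergent_lin k (pscoef_conv f) (convergent0 K n).
by congr convergent; apply/funext => m; rewrite addr0.
Qed.

Definition convps_scale (k : K) f : O := mkps (convergent_scale k f).

Fact convps_scaleA k l f : convps_scale k (convps_scale l f) = convps_scale (k * l) f.
Proof. by apply: pscoef_inj; apply/funext => m /=; rewrite mulrA. Qed.
Fact convps_scale1 : left_id 1 convps_scale.
Proof. by move=> f; apply: pscoef_inj; apply/funext => m /=; rewrite mul1r. Qed.
Fact convps_scaleDr : right_distributive convps_scale +%R.
Proof. by move=> k f g; apply: pscoef_inj; apply/funext => m /=; apply: mulrDr. Qed.
Fact convps_scaleDl f : {morph convps_scale^~ f : k l / k + l}.
Proof. by move=> k l; apply: pscoef_inj; apply/funext => m /=; apply: mulrDl. Qed.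

HB.instance Definition _ := GRing.Zmodule_isLmodule.Build K O
  convps_scaleA convps_scale1 convps_scaleDr convps_scaleDl.

Fact convps_scaleAl (k : K) f g : k *: (f * g) = k *: f * g.
Proof. by apply: pscoef_inj; rewrite /= ps_mulZl. Qed.

HB.instance Definition _ := GRing.Lmodule_isLalgebra.Build K O convps_scaleAl.
HB.instance Definition _ := GRing.Lalgebra_isComAlgebra.Build K O.

Definition convps_unit : pred O := fun f => `[< exists g, g * f = 1 >].
Definition convps_inv f : O :=
  if pselect (exists g, g * f = 1) is left e then projT1 (cid e) else f.

Fact convps_mulVr : {in convps_unit, left_inverse 1 convps_inv *%R}.
Proof.
move=> f /asboolP uf; rewrite /convps_inv; case: pselect => // e.
exact: projT2 (cid e).
Qed.
Fact convps_unitP f g : g * f = 1 -> convps_unit f.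
Proof. by move=> gf; apply/asboolP; exists g. Qed.
Fact convps_inv_out : {in [predC convps_unit], convps_inv =1 id}.
Proof.
move=> f /asboolPn nuf; rewrite /convps_inv; case: pselect => // e.
Qed.

HB.instance Definition _ := GRing.ComNzRing_hasMulInverse.Build O
  convps_mulVr convps_unitP convps_inv_out.

Definition ps_of_mpoly (p : {mpoly K[n]}) : O := mkps (convergent_mpoly p).

Definition maxideal : O -> Prop := fun f => pscoef f 0%MM = 0.

End ConvPSAlgebra.

(* Powers of an ideal: I^0 is the whole ring and I^(k+1) = I I^k, the set of  *)
(* finite sums of products.                                                   *)
Fixpoint ideal_pow (A : comNzRingType) (I : A -> Prop) (k : nat) : A -> Prop :=
  if k is k'.+1 then fun x =>
    exists2 s : seq (A * A),
      forall p, p \in s -> I p.1 /\ ideal_pow I k' p.2 &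
      x = \sum_(p <- s) p.1 * p.2
  else fun _ => True.

Section Equivalence.
Variables (K : numFieldType) (n : nat).
Local Notation O := (convps K n).
Implicit Types f g : O.

Definition right_equiv f g : Prop :=
  exists2 phi : {lrmorphism O -> O}, bijective phi & phi f = g.

(* The germs at 0 of the hypersurfaces {f = 0} and {g = 0} are isomorphic.    *)
Definition contact_equiv f g : Prop :=
  exists2 phi : {lrmorphism O -> O}, bijective phi &
    exists2 u : O, u \is a GRing.unit & phi f = u * g.

Definition determined (k : nat) f : Prop :=
  forall g, ideal_pow (@maxideal K n) k.+1 (g - f) -> right_equiv f g.

End Equivalence.

(* f is homogeneous of degree m and {f = 0} is smooth at each of its points   *)
(* of P^(n-1) (Jacobian criterion).  See regular_formP.                       *)
Definition regular_form (K : numFieldType) (n m : nat) (f : {mpoly K[n]}) : Prop :=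
  f \is m.-homog /\
  forall p : 'I_n -> K, (exists i, p i != 0) -> f.@[p] = 0 ->
    exists i, f^`M(i).@[p] != 0.

Lemma euler (K : numFieldType) (n m : nat) (f : {mpoly K[n]}) (p : 'I_n -> K) :
  f \is m.-homog -> \sum_(i < n) p i * f^`M(i).@[p] = m%:R * f.@[p].
Proof.
move=> /dhomogP hf; rewrite {2}(mpolyE f) [in RHS]raddf_sum /= mulr_sumr.
transitivity (\sum_(i < n) \sum_(k <- msupp f)
   p i * (f@_k *: 'X_[k])^`M(i).@[p]).
  apply: eq_bigr => i _; rewrite {1}(mpolyE f).
  by rewrite (raddf_sum (mderiv i)) (raddf_sum (meval p)) mulr_sumr.
rewrite exchange_big /=; apply: eq_big_seq => k kf.
have /= <- := hf _ kf; rewrite mdegE natr_sum mulr_suml.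
apply: eq_bigr => i _; rewrite mderivZ mderivX !mevalZ.
have [->|k0] := posnP (k i); first by rewrite !(mul0r, mulr0).
have uk : (U_(i) <= k)%MM by rewrite lep1mP -lt0n.
have -> : ('X_[k] : {mpoly K[n]}) = 'X_i * 'X_[k - U_(i)].
  by rewrite -mpolyXD addmC submK.
rewrite [in RHS]mevalM mevalXU [LHS]mulrCA [RHS]mulrCA; congr (_ * _).
by rewrite mulrCA.
Qed.

Lemma regular_formP (K : numFieldType) (n m : nat) (f : {mpoly K[n]}) : (0 < m)%N ->
  regular_form m f <-> f \is m.-homog /\
    forall p : 'I_n -> K, (forall i, f^`M(i).@[p] = 0) -> forall i, p i = 0.
Proof.
move=> m0; split=> -[hf reg]; split=> // p.
  move=> df i; apply/eqP; apply: contrapT => /negP pi.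
  have f0 : f.@[p] = 0.
    have := euler p hf; rewrite big1 => [/esym/eqP|j _]; last by rewrite df mulr0.
    by rewrite mulf_eq0 pnatr_eq0 eqn0Ngt m0 /= => /eqP.
  by have [|j] := reg p _ f0; [exists i | rewrite df eqxx].
move=> [i pi] _; apply: contrapT => nd.
move: pi; rewrite (reg p) ?eqxx // => j; apply: contrapT => dj; apply: nd.
by exists j; apply/eqP.
Qed.

Definition determines_germs (K : numFieldType) (n m D : nat) : Prop :=
  (m < D)%N /\
  forall (f : {mpoly K[n]}), regular_form m f ->
  forall (d : nat), (D <= d)%N ->
  forall (g : convps K n),
    ideal_pow (@maxideal K n) d (g - ps_of_mpoly f) ->
    contact_equiv (ps_of_mpoly f) g.

(* D is the least integer with the above property, written D(n, m).           *)
Definition is_Dnm (K : numFieldType) (n m D : nat) : Prop :=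
  determines_germs K n m D /\ forall D', determines_germs K n m D' -> (D <= D')%N.

Lemma is_Dnm_uniq (K : numFieldType) (n m D D' : nat) :
  is_Dnm K n m D -> is_Dnm K n m D' -> D = D'.
Proof.
by move=> [pD hD] [pD' hD']; apply/eqP; rewrite eqn_leq hD ?hD'.
Qed.

(* Main.v *)
(* Let F_1, ..., F_n be the partial derivatives of f, forms of degree e = m - 1 whose only
   common zero is 0. By the Nullstellensatz X_i^N = sum_k A_ik F_k for large N. In K[x, z],
   both the diagonal matrix of the (x_i^N - z_i^N) / (x_i - z_i) and, modulo F(x), the
   product of A(z) with the divided differences of F express x^N - z^N in terms of x - z;
   their determinants agree modulo (F(x), z^N) by Wiebe's lemma, which yields Macaulay's
   bound: every form of degree > n(e - 1) = n(m - 2) lies in (F).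

   Hence if h = g - f has order d = n(m - 2) + 1, the equation f(x + xi) = f + h reads
   sum_i xi_i F_i = h - Q(xi), with Q quadratic in xi, and can be solved for xi by a fixed
   point argument after dividing by the F_i. The components of xi have order
   d - e = (n - 1)(m - 2) >= 2, precisely because (n, m) <> (2, 3), so that x + xi is a
   change of coordinates tangent to the identity. *)

Require Import Defs.
From HB Require Import structures.
From mathcomp Require Import all_boot all_order all_algebra.
From mathcomp Require Import boolp classical_sets functions reals.
From mathcomp Require Import complex.
From mathcomp Require Import mpoly.
From mathcomp Require Import ring lra zify.
Set Implicit Arguments.
Unset Strict Implicit.
Unset Printing Implicit Defensive.

Import Order.TTheory GRing.Theory Num.Theory.
Local Open Scope ring_scope.

(** * Polynomials and ideals *)

(** Two scalings nearly cancel. Division by the partial derivatives costs e in order and r^-e in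
    norm. For a form of degree e + 1, the Taylor remainder gains e + 1 in order over the difference
    of two shifts, and has size eps^2 r^(e+1) when the shift has norm eps r. The surplus of one
    order makes the iteration contract coefficientwise; eps^2 against eps keeps it in a ball, so
    that the limit converges. Both counts need homogeneous quotients, and Macaulay's bound is
    invoked only for monomials of the single degree d, since every monomial of higher degree is a
    multiple of one of these. The equation is thus solved directly, without integrating a vector
    field as in the homotopy method. *)

Section Homogeneous.
Variables (K : comNzRingType) (n : nat).
Implicit Types (p q F : {mpoly K[n]}).

Lemma mpoly_monom_ind (P : {mpoly K[n]} -> Prop) :
  P 0 -> (forall p q, P p -> P q -> P (p + q)) ->
  (forall c p, P p -> P (c *: p)) -> (forall m, P 'X_[m]) -> forall p, P p.
Proof.
move=> P0 PD PZ PX; elim/mpolyind => // c m p _ _ Pp.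
by apply: PD => //; apply: PZ.
Qed.

Lemma mnm_ind (P : 'X_{1..n} -> Prop) :
  P 0%MM -> (forall m i, P m -> P (U_(i) + m)%MM) -> forall m, P m.
Proof.
move=> P0 PS m; have [d] := ubnP (mdeg m); elim: d m => // d IH m md.
have [->//|m0] := eqVneq m 0%MM.
have [i mi] : exists i, (0 < m i)%N.
  apply/existsP; apply: contraNT m0; rewrite negb_exists => /forallP m0.
  by apply/eqP/mnmP => i; have := m0 i; rewrite mnm0E lt0n negbK => /eqP.
have uk : (U_(i) <= m)%MM by rewrite lep1mP -lt0n.
rewrite -(submK uk) addmC; apply: PS; apply: IH.
by have := md; rewrite -{1}(submK uk) mdegD mdeg1 addn1 ltnS.
Qed.

Lemma pihomogM_homog d e p F : F \is e.-homog ->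
  pihomog mdeg (d + e) (p * F) = pihomog mdeg d p * F.
Proof.
move=> hF; elim/mpoly_monom_ind: p => [|p q IHp IHq|c p IH|m].
- by rewrite mul0r !linear0 mul0r.
- by rewrite mulrDl !linearD /= mulrDl IHp IHq.
- by rewrite -scalerAl !linearZ /= -scalerAl IH.
have hXF : 'X_[m] * F \is (mdeg m + e).-homog by rewrite dhomogM // dhomogX.
rewrite pihomogX /=; case: eqP => [<-|/eqP md]; first by rewrite pihomog_dE.
by rewrite mul0r (pihomog_ne0 _ hXF) // eqn_add2r.
Qed.

Lemma pihomogM_homog_lt d e p F : F \is e.-homog -> (d < e)%N ->
  pihomog mdeg d (p * F) = 0.
Proof.
move=> hF de; elim/mpoly_monom_ind: p => [|p q IHp IHq|c p IH|m].
- by rewrite mul0r linear0.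
- by rewrite mulrDl linearD /= IHp IHq addr0.
- by rewrite -scalerAl linearZ /= IH scaler0.
have hXF : 'X_[m] * F \is (mdeg m + e).-homog by rewrite dhomogM // dhomogX.
by rewrite (pihomog_ne0 _ hXF) // neq_ltn ltn_addl ?orbT.
Qed.

End Homogeneous.

Lemma mmap_polyC_X (R : comNzRingType) n (p : {mpoly R[n]}) :
  mmap (@mpolyC n R) (fun i => 'X_i) p = p.
Proof.
by rewrite [RHS]mpolyE; apply: eq_bigr => m _; rewrite mmap1_id mul_mpolyC.
Qed.

Section EvalDiff.
Variables (K : comNzRingType) (T : comNzRingType) (n : nat) (h : {rmorphism K -> T}).

(** Telescoping over the factors of each monomial. The [q j] act as divided differences; the free
    target [T] covers evaluation at a point, doubling of the variables and partial identification of
    the two copies. *)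
Lemma mmap_sub_ideal (u v : 'I_n -> T) (p : {mpoly K[n]}) :
  exists q : 'I_n -> T,
    mmap h u p - mmap h v p = \sum_j q j * (u j - v j).
Proof.
elim/mpoly_monom_ind: p => [|p p' [q Hq] [q' Hq']|c p [q Hq]|m].
- by exists (fun=> 0); rewrite !mmap0 subr0 big1 // => j _; rewrite mul0r.
- exists (fun j => q j + q' j); rewrite !mmapD opprD addrACA Hq Hq' -big_split.
  by apply: eq_bigr => j _; rewrite mulrDl.
- exists (fun j => h c * q j); rewrite !mmapZ -mulrBr Hq mulr_sumr.
  by apply: eq_bigr => j _; rewrite mulrA.
elim/mnm_ind: m => [|m i [q Hq]].
  exists (fun=> 0); rewrite !mmapX !mmap11 subrr big1 // => j _.
  by rewrite mul0r.
exists (fun j => u i * q j + (if j == i then mmap h v 'X_[m] else 0)).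
have hX w : mmap h w 'X_i = w i by rewrite mmapX mmap1U.
rewrite mpolyXD !rmorphM /= !hX.
under eq_bigr do rewrite mulrDl -mulrA.
rewrite big_split -mulr_sumr -Hq /= (bigD1 i) //= eqxx big1 ?addr0; first by ring.
by move=> j /negPf ->; rewrite mul0r.
Qed.

End EvalDiff.

Section Ideals.
Variables (A : comNzRingType).

Definition is_ideal (I : A -> Prop) :=
  [/\ I 0, forall a b, I a -> I b -> I (a + b) & forall c a, I a -> I (c * a)].

Definition ideal_adjoin (I : A -> Prop) (g : A) : A -> Prop :=
  fun a => exists c, I (a - c * g).

Definition ideal_span (J : finType) (F : J -> A) : A -> Prop :=
  fun a => exists q : J -> A, a = \sum_j q j * F j.

Lemma is_ideal_adjoin I g : is_ideal I -> is_ideal (ideal_adjoin I g).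
Proof.
move=> [I0 ID IM]; split.
- by exists 0; rewrite mul0r subr0.
- move=> a b [c Ic] [d Id]; exists (c + d).
  by rewrite mulrDl opprD addrACA; apply: ID.
- by move=> c a [d Id]; exists (c * d); rewrite -mulrA -mulrBr; apply: IM.
Qed.

Lemma ideal_adjoin_sub I g a : I a -> ideal_adjoin I g a.
Proof. by exists 0; rewrite mul0r subr0. Qed.

Lemma ideal_adjoin_gen I g : is_ideal I -> ideal_adjoin I g g.
Proof. by case=> I0 _ _; exists 1; rewrite mul1r subrr. Qed.

Lemma ideal_sum I (J : Type) (s : seq J) (P : pred J) (F : J -> A) : is_ideal I ->
  (forall j, P j -> I (F j)) -> I (\sum_(j <- s | P j) F j).
Proof. by move=> [I0 ID IM] H; elim/big_ind: _. Qed.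

Lemma is_ideal_span (J : finType) (F : J -> A) : is_ideal (ideal_span F).
Proof.
split.
- by exists (fun=> 0); rewrite big1 // => j _; rewrite mul0r.
- move=> _ _ [q ->] [q' ->]; exists (fun j => q j + q' j).
  by rewrite -big_split; apply: eq_bigr => j _; rewrite mulrDl.
- move=> c _ [q ->]; exists (fun j => c * q j).
  by rewrite mulr_sumr; apply: eq_bigr => j _; rewrite mulrA.
Qed.

Lemma ideal_span_gen (J : finType) (F : J -> A) j : ideal_span F (F j).
Proof.
exists (fun k => (k == j)%:R); rewrite (bigD1 j) //= eqxx mul1r big1 ?addr0 //.
by move=> k /negPf ->; rewrite mul0r.
Qed.

End Ideals.

(** * The Nullstellensatz over an uncountable field *)

Section Uncountable.
Variable R : realType.

Lemma subinterval_avoids (s : seq R) (a b : R) : a < b ->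
  exists a' b', [/\ a <= a', a' < b', b' <= b &
    forall x, x \in s -> ~~ (a' <= x <= b')].
Proof.
elim: s a b => [|y s IH] a b ab; first by exists a, b; split.
have [c [d [ac cd db ycd]]] : exists c d,
    [/\ a <= c, c < d, d <= b & ~~ (c <= y <= d)].
  pose mid := (a + b) / 2%:R; have [ym|my] := ltP y mid.
    by exists mid, b; rewrite /mid in ym *; split; try lra; apply/negP; lra.
  exists a, ((a + mid) / 2%:R); rewrite /mid in my *.
  by split; try lra; apply/negP; lra.
have [a' [b' [ca' ab' bd' H]]] := IH c d cd.
exists a', b'; split=> //; [exact: le_trans ca'|exact: le_trans db|].
move=> x; rewrite inE => /orP[/eqP ->|/H //].
apply: contra ycd => /andP[h1 h2].
by rewrite (le_trans ca' h1) (le_trans h2 bd').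
Qed.

(** Cantor's nested intervals: interval k + 1 misses the finite set [F k], and the supremum of the
    left ends lies in every interval. *)
Lemma real_not_countable_union (F : nat -> seq R) : exists x, forall k, x \notin F k.
Proof.
pose I := {p : R * R | p.1 < p.2}.
have step k (p : I) : exists q : I, [/\ (sval p).1 <= (sval q).1,
    (sval q).2 <= (sval p).2 &
    forall x, x \in F k -> ~~ ((sval q).1 <= x <= (sval q).2)].
  case: p => -[a b] /= ab.
  have [a' [b' [h1 h2 h3 h4]]] := subinterval_avoids (F k) ab.
  by exists (exist _ (a', b') h2).
pose next k p : I := sval (cid (step k p)).
have nextP k p := svalP (cid (step k p)).
pose p0 : I := exist _ (0, 1) ltr01.
pose J := fix J k : I := if k is k'.+1 then next k' (J k') else p0.
pose lo k := (sval (J k)).1; pose hi k := (sval (J k)).2.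
have loS k : lo k <= lo k.+1 by rewrite /lo /=; have [] := nextP k (J k).
have hiS k : hi k.+1 <= hi k by rewrite /hi /=; have [] := nextP k (J k).
have loD i k : lo i <= lo (k + i)%N.
  by elim: k => // k IH; apply: le_trans IH _; apply: loS.
have hiD i k : hi (k + i)%N <= hi i.
  by elim: k => // k IH; apply: le_trans IH; apply: hiS.
have lohi i j : lo i <= hi j.
  apply: le_trans (loD i j) _; rewrite addnC.
  by apply: le_trans (hiD j i); apply/ltW/(svalP (J _)).
pose E : set R := fun x => exists k, x = lo k.
have ubE j : ubound E (hi j) by move=> _ [k ->].
have hsE : has_sup E by split; [exists (lo 0%N), 0%N | exists (hi 0%N)].
exists (sup E) => k; apply/negP => xF.
have [_ _ /(_ _ xF)/negP] := nextP k (J k); apply.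
apply/andP; split; last by apply: (ge_sup _ (ubE k.+1)); case: hsE.
by apply: (ub_le_sup hsE.2); exists k.+1.
Qed.

(** If all fibres were finite, listing them would cover the reals by countably many finite sets. *)
Lemma infinite_fiber (N : R -> nat) : exists k, forall c,
  exists s : seq R, [/\ uniq s, size s = c & forall x, x \in s -> N x = k].
Proof.
apply: contrapT => /forallNP H.
have cover k : exists s : seq R, forall x, N x = k -> x \in s.
  apply: contrapT => /forallNP Hs; apply: (H k).
  elim=> [|c [s [us <- sk]]]; first by exists [::].
  have /existsNP[x /not_implyP[Nx xs]] := Hs s.
  exists (x :: s); split=> //=; first by rewrite us andbT; apply/negP.
  by move=> y; rewrite inE => /orP[/eqP ->|/sk].
have [F FP] := choice cover.
have [x xF] := real_not_countable_union F.
by have := xF (N x); rewrite FP.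
Qed.

End Uncountable.

Section Nullstellensatz.
Variables (R : realType) (K : closedFieldType) (iota : R -> K) (n : nat).
Hypothesis iota_inj : injective iota.
Local Notation S := {mpoly K[n]}.
Implicit Types (I : S -> Prop).

Lemma msize_lindep (s : seq K) (u : K -> S) (B : nat) :
  (#|{: 'X_{1..n < B}}| < size s)%N -> (forall a, a \in s -> (msize (u a) <= B)%N) ->
  exists2 l : 'I_(size s) -> K, (exists i, l i != 0) &
    \sum_i l i *: u s`_i = 0.
Proof.
set c := #|_|; move=> cs uB.
pose M : 'M[K]_(size s, c) := \matrix_(i, j) (u s`_i)@_(enum_val j : 'X_{1..n < B}).
have kM : kermx M != 0.
  rewrite kermx_eq0 /row_free; apply: contraTneq cs => <-.
  by rewrite -leqNgt rank_leq_col.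
have /rowV0Pn[v /sub_kermxP vM v0] := kM.
exists (v 0); first exact/rV0Pn.
apply/mpolyP => m; rewrite mcoeff0 raddf_sum /=.
have [mB|mB] := ltnP (mdeg m) B; last first.
  rewrite big1 // => j _; rewrite mcoeffZ; apply/eqP; rewrite mulf_eq0.
  apply/orP; right; rewrite mcoeff_eq0; apply: msize_mdeg_ge.
  by apply: leq_trans mB; apply: uB; rewrite mem_nth.
have /matrixP/(_ 0 (enum_rank (BMultinom mB))) := vM.
rewrite !mxE => /esym E; rewrite [RHS]E; apply: eq_bigr => j _.
by rewrite mcoeffZ !mxE enum_rankK.
Qed.

(* Otherwise every X_i - a has an inverse u a modulo I. By uncountability, infinitely many
   u a have the same size, hence satisfy a linear relation; clearing denominators gives a
   nonzero univariate polynomial in X_i lying in I, all of whose factors are invertible. *)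
Lemma proper_adjoin_var I (i : 'I_n) : is_ideal I -> ~ I 1 ->
  exists a : K, ~ ideal_adjoin I ('X_i - a%:MP) 1.
Proof.
move=> idI I1; have [I0 ID IM] := idI; apply: contrapT => /forallNP H.
have ex a : exists c, I (1 - c * ('X_i - a%:MP)).
  by have [c ?] := contrapT (H a); exists c.
have [u uP] := choice ex.
have [B HB] := infinite_fiber (fun x => msize (u (iota x))).
have [s0 [us0 ss0 s0B]] := HB #|{: 'X_{1..n < B}}|.+1.
pose s := map iota s0.
have us : uniq s by rewrite map_inj_uniq.
have [|a /mapP[x xs ->]|l [i0 li0] lu] := @msize_lindep s u B.
- by rewrite size_map ss0.
- by rewrite s0B.
pose P : {poly K} := \sum_(j < size s) l j *: \prod_(k < size s | k != j) ('X - (s`_k)%:P).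
have P0 : P != 0.
  suff : P.[s`_i0] != 0 by apply: contraNneq => ->; rewrite horner0.
  rewrite horner_sum (bigD1 i0) //= [X in _ + X]big1 => [|j ji].
    rewrite addr0 hornerZ mulf_neq0 // horner_prod prodf_seq_neq0.
    apply/allP => k _; apply/implyP => ki.
    by rewrite hornerXsubC subr_eq0 nth_uniq // eq_sym.
  rewrite hornerZ horner_prod (bigD1 i0) ?hornerXsubC 1?eq_sym //=.
  by rewrite subrr mul0r mulr0.
pose ev (p : {poly K}) : S := (map_poly (@mpolyC n K) p).['X_i].
have evX a : ev ('X - a%:P) = 'X_i - a%:MP.
  by rewrite /ev rmorphB /= map_polyX map_polyC hornerXsubC.
have evM p q : ev (p * q) = ev p * ev q by rewrite /ev rmorphM hornerM.
have evZ c p : ev (c *: p) = c *: ev p.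
  by rewrite /ev -mul_polyC rmorphM /= map_polyC hornerM hornerC mul_mpolyC.
(* Modulo I, the product over k != j is [u] at the j-th point times the full product, so [ev P] is
   congruent to the full product times the vanishing combination [lu]. *)
have IP : I (ev P).
  pose Q (A : pred 'I_(size s)) := \prod_(k < size s | A k) ('X_i - (s`_k)%:MP : S).
  have evP : ev P = \sum_(j < size s) l j *: Q (predC1 j).
    rewrite /ev /P raddf_sum horner_sum; apply: eq_bigr => j _.
    rewrite -[LHS]/(ev _) evZ; congr (_ *: _).
    rewrite /ev rmorph_prod horner_prod; apply: eq_bigr => k _.
    by rewrite -[LHS]/(ev _) evX.
  suff : I (ev P - (\sum_(j < size s) l j *: u s`_j) * Q predT).
    by rewrite lu mul0r subr0.
  rewrite evP mulr_suml -sumrB; apply: ideal_sum => // j _.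
  have -> : Q predT = ('X_i - (s`_j)%:MP) * Q (predC1 j) by rewrite /Q (bigD1 j).
  have -> : l j *: Q (predC1 j) - l j *: u s`_j * (('X_i - (s`_j)%:MP) * Q (predC1 j))
     = (l j *: Q (predC1 j)) * (1 - u s`_j * ('X_i - (s`_j)%:MP)).
    by rewrite -!mul_mpolyC; ring.
  exact: IM.
have [rs Prs] := closed_field_poly_normal P.
have cancel q a : I (q * ('X_i - a%:MP)) -> I q.
  move=> Iq; have -> : q = q * (1 - u a * ('X_i - a%:MP)) + u a * (q * ('X_i - a%:MP)).
    by ring.
  by apply: ID; apply: IM.
have : I (lead_coef P)%:MP.
  move: IP; rewrite {1}Prs evZ -mul_mpolyC.
  elim: rs {Prs} => [|r rs IH]; first by rewrite big_nil /ev rmorph1 hornerC mulr1.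
  by rewrite big_cons evM mulrCA mulrC evX => /cancel.
move=> /(IM (lead_coef P)^-1%:MP); rewrite -mpolyCM mulVf ?lead_coef_eq0 //.
Qed.

(** For each variable in turn some [X_i - a i] can be adjoined with the ideal staying proper. Modulo
    these, p is the constant p(a), a unit if nonzero. *)
Theorem weak_nullstellensatz I : is_ideal I -> ~ I 1 ->
  exists a : 'I_n -> K, forall p, I p -> p.@[a] = 0.
Proof.
move=> idI I1.
suff [a [J [idJ IJ J1 Ja]]] : exists (a : 'I_n -> K) (J : S -> Prop),
    [/\ is_ideal J, forall p, I p -> J p, ~ J 1 & forall i, J ('X_i - (a i)%:MP)].
  exists a => p /IJ Jp; apply: contrapT => /eqP pa; apply: J1.
  have [J0 JD JM] := idJ.
  have [q Hq] := mmap_sub_ideal (@mpolyC n K) (fun i => 'X_i) (fun i => (a i)%:MP) p.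
  have Jpa : J (p.@[a])%:MP.
    have -> : (p.@[a])%:MP = p + (-1) * \sum_j q j * ('X_j - (a j)%:MP).
      have ma : mmap (@mpolyC n K) (fun i => (a i)%:MP) p = (p.@[a])%:MP.
        rewrite /meval /mmap rmorph_sum /=; apply: eq_bigr => m _.
        rewrite rmorphM /mmap1 rmorph_prod; congr (_ * _).
        by apply: eq_bigr => i _; rewrite rmorphXn.
      by rewrite -Hq mmap_polyC_X ma mulN1r opprB addrCA subrr addr0.
    apply: JD => //; apply/JM; apply: ideal_sum => // j _; exact: JM.
  by move: Jpa => /(JM (p.@[a])^-1%:MP); rewrite -mpolyCM mulVf.
suff {}H k : (k <= n)%N -> exists (a : 'I_n -> K) (J : S -> Prop),
    [/\ is_ideal J, forall p, I p -> J p, ~ J 1 &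
        forall i : 'I_n, (i < k)%N -> J ('X_i - (a i)%:MP)].
  have [a [J [h1 h2 h3 h4]]] := H n (leqnn n).
  by exists a, J; split=> // i; apply: h4.
elim: k => [_|k IH kn]; first by exists (fun=> 0), I; split.
have [a [J [idJ IJ J1 Ja]]] := IH (ltnW kn).
pose ik := Ordinal kn; have [b Jb] := proper_adjoin_var ik idJ J1.
exists (fun i => if i == ik then b else a i), (ideal_adjoin J ('X_ik - b%:MP)).
split=> //; first exact: is_ideal_adjoin.
  by move=> p /IJ; apply: ideal_adjoin_sub.
move=> i; rewrite ltnS leq_eqVlt => /orP[/eqP ik'|ik'].
  have -> : i = ik by apply: val_inj.
  by rewrite eqxx; apply: ideal_adjoin_gen.
have /negPf -> : i != ik by rewrite -val_eqE neq_ltn ik'.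
exact/ideal_adjoin_sub/Ja.
Qed.

End Nullstellensatz.

Section HomogeneousNullstellensatz.
Variables (R : realType) (K : closedFieldType) (iota : R -> K) (n : nat).
Hypothesis iota_inj : injective iota.
Local Notation S := {mpoly K[n]}.

(** The variable ['X_i] itself serves as homogenizing variable. Components of degree above N are
    dropped, so that for fixed N the map is additive on all polynomials. *)
Definition homogenize (i : 'I_n) (N : nat) (p : S) : S :=
  \sum_(s < N.+1) pihomog mdeg s p * 'X_i ^+ (N - s).

Lemma homogenizeD i N : {morph homogenize i N : p q / p + q}.
Proof.
move=> p q; rewrite -big_split; apply: eq_bigr => s _.
by rewrite linearD mulrDl.
Qed.

Lemma homogenize_homog i N p : homogenize i N p \is N.-homog.
Proof.
apply: rpred_sum => s _; have sN : (s <= N)%N by rewrite -ltnS.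
have hX : ('X_i : S) \is 1.-homog by rewrite dhomogX /= mdeg1.
have := dhomogM (pihomogP mdeg s p) (dhomogMn (N - s) hX).
by rewrite mul1n subnKC.
Qed.

Lemma homogenize1 i N : homogenize i N 1 = 'X_i ^+ N.
Proof.
rewrite /homogenize big_ord_recl big1 ?addr0 => [|s _].
  by rewrite pihomog_dE ?mul1r ?subn0 // dhomog1.
by rewrite (pihomog_ne0 _ (dhomog1 _ _)) // mul0r.
Qed.

Lemma homogenizeM_homog i N e p F : F \is e.-homog -> (e <= N)%N ->
  homogenize i N (p * F) = homogenize i (N - e) p * F.
Proof.
move=> hF eN; rewrite /homogenize -(big_mkord xpredT
  (fun s => pihomog mdeg s (p * F) * 'X_i ^+ (N - s))).
rewrite (big_cat_nat (n := e)) // ?leqW //= big_nat big1 ?add0r => [|s se].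
  rewrite -{1}(add0n e) big_addn subSn // big_mkord mulr_suml.
  by apply: eq_bigr => s _; rewrite pihomogM_homog // addnC subnDA mulrAC.
by rewrite (pihomogM_homog_lt _ hF) ?mul0r.
Qed.

Lemma pihomog_large N (p : S) : (msize p <= N)%N -> pihomog mdeg N p = 0.
Proof.
move=> pN; rewrite (pihomogwE _ _ pN) big_pred0 // => m.
by rewrite ltn_eqF // bmdeg.
Qed.

(** A factor ['X_i] raises the degree by one and uses up one padding factor. The size bound ensures
    that no component of q is cut off. *)
Lemma homogenize_var i N q : (msize q < N)%N ->
  homogenize i N (q * 'X_i) = homogenize i N q.
Proof.
case: N => // N qN; rewrite (homogenizeM_homog _ _ (e := 1)) ?dhomogX /= ?mdeg1 //.
rewrite subn1 /= {2}/homogenize big_ord_recr /= pihomog_large 1?ltnW // mul0r addr0.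
rewrite mulr_suml; apply: eq_bigr => s _.
by rewrite -mulrA -exprSr subSn // -ltnS.
Qed.

(* By the weak Nullstellensatz 1 is in (F, X_i - 1); homogenizing with respect to X_i kills
   the multiples of X_i - 1. *)
Theorem homogeneous_nullstellensatz (J : finType) (F : J -> S) (e : nat) :
  (forall k, F k \is e.-homog) ->
  (forall p : 'I_n -> K, (forall k, (F k).@[p] = 0) -> forall i, p i = 0) ->
  exists N0, forall N, (N0 <= N)%N -> forall i, exists A : J -> S,
    (forall k, A k \is (N - e).-homog) /\ 'X_i ^+ N = \sum_k A k * F k.
Proof.
move=> hF F0.
suff H i : exists N0, forall N, (N0 <= N)%N -> exists A : J -> S,
    (forall k, A k \is (N - e).-homog) /\ 'X_i ^+ N = \sum_k A k * F k.
  have [M HM] := choice H; exists (\max_i M i) => N MN i.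
  by apply: HM; apply: leq_trans MN; apply: leq_bigmax.
have idF := is_ideal_span F.
have : ideal_adjoin (ideal_span F) ('X_i - 1%:MP) 1.
  apply: contrapT => /(weak_nullstellensatz iota_inj (is_ideal_adjoin _ idF)).
  move=> [a Ha]; have ai : a i = 0.
    by apply: F0 => k; apply/Ha/ideal_adjoin_sub/ideal_span_gen.
  have := Ha _ (ideal_adjoin_gen _ idF).
  by rewrite mevalB mevalXU mevalC ai sub0r => /eqP; rewrite oppr_eq0 oner_eq0.
move=> [q [g Hg]]; exists (maxn e (msize q).+1) => N; rewrite geq_max => /andP[eN qN].
exists (fun k => homogenize i (N - e) (g k)); split=> [k|].
  exact: homogenize_homog.
(* Arranged so that q and [q * 'X_i] homogenize to the same form and cancel. *)
have E : 1 + q = \sum_k g k * F k + q * 'X_i.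
  by rewrite -Hg mpolyC1 mulrBr mulr1; ring.
have /= := congr1 (homogenize i N) E; rewrite !homogenizeD homogenize1 homogenize_var //.
move/addIr => ->; rewrite (big_morph _ (homogenizeD i N) (id1 := 0)).
  by apply: eq_bigr => k _; apply: homogenizeM_homog.
by rewrite /homogenize big1 // => s _; rewrite linear0 mul0r.
Qed.

End HomogeneousNullstellensatz.

(** * Macaulay's bound *)

Section IdealCongruence.
Variables (A : comNzRingType) (I : A -> Prop).
Hypothesis idI : is_ideal I.

Lemma ideal_congr_trans b a c : I (a - b) -> I (b - c) -> I (a - c).
Proof.
have [_ ID _] := idI => ab bc; have -> : a - c = (a - b) + (b - c) by ring.
exact: ID.
Qed.

Lemma ideal_congr_mulr a b c d : I (b - a * d) -> I (a * c) -> I (b * c).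
Proof.
have [_ ID IM] := idI => bad ac.
have -> : b * c = c * (b - a * d) + d * (a * c) by ring.
by apply: ID; apply: (IM).
Qed.

Lemma ideal_det_congr n (M M' : 'M[A]_n) :
  (forall i j, I (M i j - M' i j)) -> I (\det M - \det M').
Proof.
have [I0 ID IM] := idI => H; rewrite /determinant -sumrB.
apply: ideal_sum => // s _; rewrite -mulrBr; apply: (IM).
apply: (big_ind2 (fun a b => I (a - b))) => [|a b c d ab cd|i _] //.
  by rewrite subrr.
have -> : a * c - b * d = a * (c - d) + d * (a - b) by ring.
by apply: ID; apply: (IM).
Qed.

(** The cofactors of row i are the generalized cross product of the other rows. These are orthogonal
    to w modulo I, so the cross product is parallel to w in the sense of 2x2 minors. *)
Lemma ideal_cofactor_parallel n (M : 'M[A]_n) (w : 'I_n -> A) (i j k : 'I_n) :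
  (forall l, l != i -> I (\sum_p M l p * w p)) ->
  I (w k * cofactor M i j - w j * cofactor M i k).
Proof.
have [I0 ID IM] := idI => HM.
(* Replacing row i by the k-th unit vector leaves the cofactors of row i alone,
   turns the determinant into the (i,k) cofactor and (M w)_i into w_k. *)
pose M' : 'M[A]_n := \matrix_(a, b) if a == i then (b == k)%:R else M a b.
have cofM' l : cofactor M' i l = cofactor M i l.
  rewrite /cofactor; congr (_ * \det _); apply/matrixP => a b.
  by rewrite !mxE eq_sym (negPf (neq_lift _ _)).
have detM' : \det M' = cofactor M i k.
  rewrite (expand_det_row _ i) (bigD1 k) //= big1 => [|b bk].
    by rewrite !mxE !eqxx mul1r addr0 cofM'.
  by rewrite !mxE eqxx (negPf bk) mul0r.
pose wc : 'cV[A]_n := \col_p w p.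
have /matrixP/(_ j 0) : \adj M' *m (M' *m wc) = \det M' *: wc.
  by rewrite mulmxA mul_adj_mx mul_scalar_mx.
rewrite !mxE (bigD1 i) //= detM' [X in X * _]mxE cofM'.
have -> : (M' *m wc) i 0 = w k.
  rewrite mxE (bigD1 k) //= big1 => [|b bk]; rewrite !mxE !eqxx ?mul1r ?addr0 //.
  by rewrite (negPf bk) mul0r.
move=> E; have -> : w k * cofactor M i j - w j * cofactor M i k =
    - 1 * \sum_(l | l != i) (\adj M') j l * (M' *m wc) l 0.
  by rewrite [w j * _]mulrC -E; ring.
apply: (IM); apply: ideal_sum => // l li; apply: (IM).
rewrite mxE; under eq_bigr do rewrite !mxE (negPf li).
exact: HM.
Qed.

End IdealCongruence.

Section RegularSequence.
Variables (A : comNzRingType) (n : nat) (w : 'I_n -> A).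

Definition regular_seq := forall (p : 'I_n) (a : A),
  (exists t : 'I_n -> A, a * w p = \sum_(k < n | (k < p)%N) t k * w k) ->
  exists t : 'I_n -> A, a = \sum_(k < n | (k < p)%N) t k * w k.

Hypothesis wreg : regular_seq.
Variable I : A -> Prop.
Hypothesis idI : is_ideal I.

(* The syzygies of w are generated by the Koszul relations w_k e_j - w_j e_k,
   on which the linear form c takes values in I. *)
Lemma regular_seq_syzygy (c d : 'I_n -> A) :
  (forall j k, I (w k * c j - w j * c k)) ->
  \sum_j d j * w j = 0 -> I (\sum_j d j * c j).
Proof.
have [I0 ID IM] := idI => Hc.
suff H p : (p <= n)%N -> forall d : 'I_n -> A,
    \sum_(j < n | (j < p)%N) d j * w j = 0 -> I (\sum_(j < n | (j < p)%N) d j * c j).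
  move=> Hd; have := H n (leqnn n) d.
  have E (G : 'I_n -> A) : \sum_(j < n | (j < n)%N) G j = \sum_j G j.
    by apply: eq_bigl => j; rewrite ltn_ord.
  by rewrite !E; apply.
elim: p => [_ ? _|p IH pn {}d]; first by rewrite big1.
pose ip := Ordinal pn.
have split_sum (G : 'I_n -> A) : \sum_(j < n | (j < p.+1)%N) G j =
    G ip + \sum_(j < n | (j < p)%N) G j.
  rewrite (bigD1 ip) //=; congr (_ + _); apply: eq_bigl => j.
  by rewrite -val_eqE /= ltnS [RHS]ltn_neqAle andbC.
rewrite !split_sum => Hd.
have [|t Ht] := wreg (p := ip) (a := d ip).
  exists (fun k => - d k); apply/eqP; rewrite -subr_eq0 -sumrN.
  by rewrite -[X in _ == X]Hd; apply/eqP; congr (_ + _); apply: eq_bigr => k _; rewrite mulNr opprK.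
(* By regularity [d ip] is a combination of the earlier w; substituting it leaves a shorter syzygy,
   up to Koszul relations. *)
have Id' : I (\sum_(j < n | (j < p)%N) (d j + t j * w ip) * c j).
  apply: IH; first exact: ltnW.
  rewrite -[RHS]Hd Ht mulr_suml -big_split; apply: eq_bigr => j _ /=; ring.
have -> : d ip * c ip + \sum_(j < n | (j < p)%N) d j * c j =
   \sum_(j < n | (j < p)%N) (d j + t j * w ip) * c j +
   \sum_(j < n | (j < p)%N) t j * (w j * c ip - w ip * c j).
  by rewrite Ht mulr_suml -!big_split; apply: eq_bigr => j _ /=; ring.
by apply: ID => //; apply: ideal_sum => // j _; apply: (IM).
Qed.

(* Wiebe's lemma: C is turned into C' one row at a time, and the difference of two
   exchanged rows is a syzygy of w. *)
Lemma regular_seq_det_uniq (C C' : 'M[A]_n) :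
  (forall l, \sum_p C l p * w p = \sum_p C' l p * w p) ->
  (forall l, I (\sum_p C l p * w p)) -> I (\det C - \det C').
Proof.
have [I0 ID IM] := idI => CC' IC.
pose D p : 'M[A]_n := \matrix_(i, j) if (i < p)%N then C' i j else C i j.
have ID' p l : I (\sum_k D p l k * w k).
  under eq_bigr do rewrite mxE.
  by case: (l < p)%N; rewrite -?CC'; apply: IC.
have DS (p : 'I_n) : I (\det (D p) - \det (D p.+1)).
  have cofD j : cofactor (D p.+1) p j = cofactor (D p) p j.
    rewrite /cofactor; congr (_ * \det _); apply/matrixP => a b; rewrite !mxE.
    by rewrite ltnS leq_eqVlt val_eqE eq_sym (negPf (neq_lift _ _)).
  rewrite !(expand_det_row _ p) -sumrB.
  under eq_bigr do rewrite cofD -mulrBl !mxE ltnn ltnSn.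
  apply: regular_seq_syzygy => [j k|].
    by apply: (ideal_cofactor_parallel idI) => l _; apply: ID'.
  by under eq_bigr do rewrite mulrBl; rewrite sumrB CC' subrr.
have H p : (p <= n)%N -> I (\det C - \det (D p)).
  elim: p => [_|p IH pn].
    suff -> : D 0%N = C by rewrite subrr.
    by apply/matrixP => i j; rewrite mxE.
  by apply: (ideal_congr_trans idI) (IH (ltnW pn)) (DS (Ordinal pn)).
suff <- : D n = C' by apply: H.
by apply/matrixP => i j; rewrite mxE ltn_ord.
Qed.

End RegularSequence.

Lemma mcoeff_mulX (R : nzRingType) n (p : {mpoly R[n]}) m k :
  (p * 'X_[m])@_k = if (m <= k)%MM then p@_(k - m) else 0.
Proof.
case: ifP => mk; first by rewrite -{1}(submK mk) addmC mcoeffMX.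
elim/mpolyind: p => [|c a p _ _ IH]; first by rewrite mul0r mcoeff0.
rewrite mulrDl mcoeffD IH addr0 -scalerAl mcoeffZ -mpolyXD mcoeffX.
by case: eqP => [ak|_]; [rewrite -ak lem_addl in mk | rewrite mulr0].
Qed.

Section Bezoutian.
Variables (S T : comNzRingType) (n N : nat) (u v : {rmorphism S -> T}).
Variables (X F : 'I_n -> S) (z x : 'I_n -> T) (A : 'M[S]_n).
Hypotheses (uX : forall i, u (X i) = z i) (vX : forall i, v (X i) = x i).
Hypothesis uv_diff : forall p, exists q : 'I_n -> T,
  u p - v p = \sum_j q j * (z j - x j).
Hypothesis uv_reg : regular_seq (fun j => z j - x j).
Hypothesis XA : forall i, X i ^+ N = \sum_k A i k * F k.
Variable I : T -> Prop.
Hypothesis idI : is_ideal I.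
Hypothesis IF : forall k, I (v (F k)).
Hypothesis IX : forall i, I (z i ^+ N).

(* Both sides are determinants of matrices expressing u(X^N) - v(X^N) in terms
   of u(X) - v(X): a diagonal one, and one that is u(A) times the divided
   differences of F modulo the v(F k). *)
Lemma bezoutian_congr : exists P,
  I (\prod_i (\sum_(a < N) z i ^+ (N.-1 - a) * x i ^+ a) - u (\det A) * P).
Proof.
have [I0 ID IM] := idI.
have [al Hal] := choice (fun ik : 'I_n * 'I_n => uv_diff (A ik.1 ik.2)).
have [ph Hph] := choice (fun k => uv_diff (F k)).
pose b i := \sum_(a < N) z i ^+ (N.-1 - a) * x i ^+ a.
pose C : 'M[T]_n := diag_mx (\row_i b i).
(* Discrete Leibniz rule for [A i k * F k]; the second summand lies in I because [v (F k)] does. *)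
pose C' : 'M[T]_n := \matrix_(i, j) \sum_k (u (A i k) * ph k j + al (i, k) j * v (F k)).
pose Phi : 'M[T]_n := \matrix_(k, j) ph k j.
have HC i : \sum_j C i j * (z j - x j) = z i ^+ N - x i ^+ N.
  rewrite (bigD1 i) //= big1 => [|j ji].
    by rewrite addr0 subrXX [LHS]mulrC !mxE eqxx mulr1n.
  by rewrite !mxE eq_sym (negPf ji) mulr0n mul0r.
have HC' i : \sum_j C' i j * (z j - x j) = z i ^+ N - x i ^+ N.
  rewrite -uX -vX -!rmorphXn XA !rmorph_sum -sumrB.
  under eq_bigr do rewrite mxE mulr_suml.
  rewrite exchange_big /=; apply: eq_bigr => k _; rewrite !rmorphM.
  have -> : u (A i k) * u (F k) - v (A i k) * v (F k) =
    u (A i k) * (u (F k) - v (F k)) + (u (A i k) - v (A i k)) * v (F k) by ring.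
  rewrite Hph (Hal (i, k)) mulr_sumr mulr_suml -big_split; apply: eq_bigr => j _ /=.
  by ring.
have Idet : I (\det C - \det C').
  apply: (regular_seq_det_uniq uv_reg idI) => l; first by rewrite HC HC'.
  rewrite HC -mulN1r; apply: ID => //; apply: (IM).
  rewrite -vX -rmorphXn XA rmorph_sum; apply: ideal_sum => // k _.
  by rewrite rmorphM; apply: IM.
have IC' : I (\det C' - \det (map_mx u A *m Phi)).
  apply: ideal_det_congr => // i j; rewrite !mxE -sumrB; apply: ideal_sum => // k _.
  by rewrite !mxE addrC addKr; apply: IM.
exists (\det Phi); rewrite -det_map_mx -det_mulmx.
suff <- : \det C = \prod_i b i by apply: (ideal_congr_trans idI) Idet IC'.
by rewrite det_diag; apply: eq_bigr => i _; rewrite mxE.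
Qed.

End Bezoutian.

Section Doubling.
Variables (K : idomainType) (n : nat).
Local Notation S := {mpoly K[n]}.
Local Notation T := {mpoly S[n]}.

(** The doubled ring is nested, polynomials in z over K[x], so that a coefficient with respect to z
    is again an element of K[x]. *)
Definition dblC : K -> T := @mpolyC n S \o @mpolyC n K.
HB.instance Definition _ := GRing.RMorphism.on dblC.

Local Notation z := (fun i : 'I_n => 'X_i : T).
Local Notation x := (fun i : 'I_n => ('X_i : S)%:MP_[n] : T).

Lemma mmap_dblx (p : S) : mmap dblC x p = p%:MP.
Proof.
rewrite -[p in RHS]mmap_polyC_X /mmap rmorph_sum; apply: eq_bigr => m _.
rewrite rmorphM; congr (_ * _); rewrite /mmap1 rmorph_prod.
by apply: eq_bigr => i _; rewrite rmorphXn.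
Qed.

Lemma doubling_eval : exists u : {rmorphism S -> T}, (forall i, u 'X_i = z i) /\
  forall p, exists q : 'I_n -> T, u p - p%:MP = \sum_j q j * (z j - x j).
Proof.
exists (mmap dblC z); split=> [i|p]; first by rewrite /= mmapX mmap1U.
have [q Hq] := mmap_sub_ideal dblC z x p; rewrite mmap_dblx in Hq.
by exists q.
Qed.

(** Setting z_k = x_k for k < p kills exactly the ideal of the earlier differences. It fixes z_p -
    x_p, which is nonzero in a domain and can be cancelled. *)
Lemma doubling_regular_seq : regular_seq (fun i => z i - x i).
Proof.
move=> p a [t Ht].
pose v (k : 'I_n) : T := if (k < p)%N then x k else z k.
pose rho : {rmorphism T -> T} := mmap (@mpolyC n S) v.
have rhoC c : rho c%:MP = c%:MP by rewrite /rho /= mmapC.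
have rhoX k : rho 'X_k = v k by rewrite /rho /= mmapX mmap1U.
have zx_neq0 : z p - x p != 0.
  apply/eqP => /(congr1 (mcoeff U_(p))) /eqP.
  rewrite mcoeffB mcoeffXU eqxx mcoeffC mnm1_eq0 mulr0 subr0 mcoeff0.
  by rewrite oner_eq0.
have rho_a : rho a = 0.
  have := congr1 rho Ht; rewrite rmorphM rmorphB rhoC rhoX /v ltnn.
  rewrite rmorph_sum big1 => [/eqP|k kp].
    by rewrite mulf_eq0 (negPf zx_neq0) orbF => /eqP.
  by rewrite rmorphM rmorphB rhoC rhoX /v kp subrr mulr0.
have [q Hq] := mmap_sub_ideal (@mpolyC n S) z v a.
have -> : a = \sum_j q j * (z j - v j).
  by rewrite -Hq -[mmap _ v a]/(rho a) rho_a subr0 mmap_polyC_X.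
exists q; rewrite (bigID (fun k : 'I_n => k < p)%N) /= [X in _ + X]big1 ?addr0.
  by apply: eq_bigr => k kp; rewrite /v kp.
by move=> k /negPf kp; rewrite /v kp subrr mulr0.
Qed.

(** A multiple of z_i^N has no monomial z^mu with mu_i < N, and the [F k], being free of z, commute
    with coefficient extraction. *)
Lemma mcoeff_ideal (F : 'I_n -> S) (N : nat) (mu : 'X_{1..n}) (P : T) :
  (forall i, (mu i < N)%N) ->
  ideal_span (fun s : 'I_n + 'I_n =>
    match s with inl k => (F k)%:MP | inr i => z i ^+ N end) P ->
  ideal_span F P@_mu.
Proof.
move=> muN [q ->]; rewrite raddf_sum /= big_sumType /=.
exists (fun k => (q (inl k))@_mu); rewrite [X in _ + X]big1 ?addr0 => [|i _].
  by apply: eq_bigr => k _; rewrite mulrC mcoeffCM mulrC.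
rewrite mpolyXn mcoeff_mulX; case: ifP => // /mnm_lepP/(_ i).
by rewrite mulmnE mnm1E eqxx mul1n leqNgt muN.
Qed.

(** Expanding the product, the choice f of exponents contributes z^(N-1-f+beta) x^f, which has the
    required z-degree only for f = beta. *)
Lemma mcoeff_bezoutian (N : nat) (beta : 'X_{1..n}) :
  (forall i, (beta i < N)%N) ->
  (\prod_i (\sum_(a < N) z i ^+ (N.-1 - a) * x i ^+ a) *
    ('X_[beta] : T))@_[multinom N.-1 | i < n] = 'X_[beta].
Proof.
move=> bN; rewrite mpolyXE_id -big_split /=.
under eq_bigr => i _ do rewrite mulr_suml.
rewrite bigA_distr_bigA raddf_sum /=.
have E (f : {ffun 'I_n -> 'I_N}) :
  (\prod_i (z i ^+ (N.-1 - f i) * x i ^+ f i * z i ^+ beta i))@_[multinom N.-1 | i < n]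
  = if f == [ffun i => Ordinal (bN i)] then 'X_[beta] else 0.
  have -> : \prod_i (z i ^+ (N.-1 - f i) * x i ^+ f i * z i ^+ beta i) =
     ('X_[[multinom f i : nat | i < n]] : S)%:MP *
     'X_[[multinom (N.-1 - f i + beta i)%N | i < n]].
    rewrite !mpolyXE_id rmorph_prod -big_split; apply: eq_bigr => i _ /=.
    by rewrite !mnmE rmorphXn exprD mulrAC mulrC.
  rewrite mcoeffCM mcoeffX; case: (f =P _) => [->|/eqP fb].
    rewrite (_ : _ == _); last first.
      by apply/eqP/mnmP => i; rewrite !mnmE ffunE /= subnK // -ltnS prednK ?(leq_ltn_trans _ (bN i)).
    by rewrite mulr1; congr 'X_[_]; apply/mnmP => i; rewrite mnmE ffunE.
  rewrite (_ : _ == _ = false) ?mulr0 //; apply: contraNF fb => /eqP/mnmP H.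
  apply/eqP/ffunP => i; apply: val_inj; rewrite ffunE /=.
  have := H i; rewrite !mnmE; have := ltn_ord (f i); have := bN i; lia.
by rewrite (bigD1 [ffun i => Ordinal (bN i)]) //= E eqxx big1 ?addr0 // => f /negPf fb; rewrite E fb.
Qed.

Lemma ideal_span_large_power N (p : S) :
  (forall m, m \in msupp p -> exists i, (N <= m i)%N) ->
  ideal_span (fun i : 'I_n => 'X_i ^+ N) p.
Proof.
move=> H; rewrite [p]mpolyE big_seq; apply: ideal_sum => [|m /H [i Ni]].
  exact: is_ideal_span.
have [_ _ IM] := is_ideal_span (fun i : 'I_n => 'X_i ^+ N : S).
have uk : (U_(i) *+ N <= m)%MM.
  apply/mnm_lepP => j; rewrite mulmnE mnm1E.
  by case: eqP => [<-|_]; rewrite ?mul1n ?mul0n.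
rewrite -(submK uk) mpolyXD -mpolyXn -mul_mpolyC mulrA; apply: IM.
exact: ideal_span_gen.
Qed.

Lemma dhomog_prod_const (J : finType) d (G : J -> S) :
  (forall i, G i \is d.-homog) -> \prod_i G i \is (#|J| * d).-homog.
Proof.
move=> hG; rewrite -sum_nat_const.
elim/big_rec2: _ => [|i k p _ hp]; first exact: dhomog1.
exact: dhomogM.
Qed.

Lemma dhomog_det d (M : 'M[S]_n) :
  (forall i j, M i j \is d.-homog) -> \det M \is (n * d).-homog.
Proof.
move=> hM; apply: rpred_sum => s _; rewrite -signr_odd mulr_sign.
have := dhomog_prod_const (fun i => hM i (perm.fun_of_perm s i)); rewrite card_ord => H.
by case: ifP => _; rewrite ?rpredN.
Qed.

(* For degree reasons det A * X^beta lies in (X_1^N, ..., X_n^N). Multiplying the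
   congruence of bezoutian_congr by z^beta and extracting the coefficient of
   z^(N-1, ..., N-1) then turns its left-hand side into X^beta. *)
Theorem macaulay_bound (F : 'I_n -> S) (e N : nat) (A : 'I_n -> 'I_n -> S)
    (beta : 'X_{1..n}) :
  (forall k, F k \is e.-homog) ->
  (forall i k, A i k \is (N - e).-homog) -> (e <= N)%N ->
  (forall i, 'X_i ^+ N = \sum_k A i k * F k) ->
  (n * e.-1 < mdeg beta)%N -> (mdeg beta < N)%N -> (0 < e)%N ->
  ideal_span F 'X_[beta].
Proof.
move=> hF hA eN HXN e_beta betaN e0.
have bN i : (beta i < N)%N.
  apply: leq_ltn_trans betaN; rewrite mdegE (bigD1 i) //=; exact: leq_addr.
pose gens (s : 'I_n + 'I_n) : T :=
  match s with inl k => (F k)%:MP | inr i => z i ^+ N end.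
have idI := is_ideal_span gens; have [_ ID IM] := idI.
have [u [uX udiff]] := doubling_eval.
have [P HP] : exists P, ideal_span gens (\prod_i (\sum_(a < N) z i ^+ (N.-1 - a) * x i ^+ a) -
    u (\det (\matrix_(i, k) A i k)) * P).
  apply: (@bezoutian_congr S T n N u (@mpolyC n S) (fun i => 'X_i) F z x
    (\matrix_(i, k) A i k)) => // [|i|k|i].
  - exact: doubling_regular_seq.
  - by rewrite HXN; apply: eq_bigr => k _; rewrite mxE.
  - exact: (ideal_span_gen gens (inl k)).
  - exact: (ideal_span_gen gens (inr i)).
have Hbeta : ideal_span gens (u (\det (\matrix_(i, k) A i k) * 'X_[beta])).
  have [|q ->] := @ideal_span_large_power N (\det (\matrix_(i, k) A i k) * 'X_[beta]).
    have hdet : \det (\matrix_(i, k) A i k) * 'X_[beta] \is (n * (N - e) + mdeg beta).-homog.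
      by apply: dhomogM; rewrite ?dhomogX //; apply: dhomog_det => i j; rewrite mxE.
    move/dhomogP: hdet => hdet m /hdet /= md; apply/existsP; apply: contraT.
    rewrite negb_exists => /forallP mN.
    (* Exponents all below N would bound the degree by n(N-1). The actual degree n(N-e) + |beta|
       exceeds this precisely when |beta| > n(e-1): this is the origin of Macaulay's number. *)
    have : (mdeg m <= \sum_(i < n) N.-1)%N.
      rewrite mdegE; apply: leq_sum => i _; have := mN i; lia.
    by rewrite sum_nat_const card_ord md; nia.
  rewrite rmorph_sum; apply: ideal_sum => // i _.
  by rewrite rmorphM rmorphXn uX; apply: IM; apply: (ideal_span_gen gens (inr i)).
have {HP Hbeta} : ideal_span gens
    (\prod_i (\sum_(a < N) z i ^+ (N.-1 - a) * x i ^+ a) * 'X_[beta]).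
  have uXb : u 'X_[beta] = 'X_[beta].
    by rewrite !mpolyXE_id rmorph_prod; apply: eq_bigr => i _; rewrite rmorphXn uX.
  rewrite rmorphM uXb in Hbeta; exact: (ideal_congr_mulr idI HP Hbeta).
move=> /(mcoeff_ideal (mu := [multinom N.-1 | i < n])).
rewrite mcoeff_bezoutian //; apply => i; rewrite mnmE.
by rewrite prednK ?(leq_ltn_trans _ (bN i)).
Qed.

End Doubling.

Theorem forms_socle_bound (R : realType) (K : closedFieldType) (iota : R -> K)
    (n e : nat) (F : 'I_n -> {mpoly K[n]}) (beta : 'X_{1..n}) :
  injective iota -> (0 < e)%N -> (forall k, F k \is e.-homog) ->
  (forall p : 'I_n -> K, (forall k, (F k).@[p] = 0) -> forall i, p i = 0) ->
  (n * e.-1 < mdeg beta)%N ->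
  exists P : 'I_n -> {mpoly K[n]},
    (forall k, P k \is (mdeg beta - e).-homog) /\ 'X_[beta] = \sum_k P k * F k.
Proof.
move=> iota_inj e0 hF F0 bn.
have n0 : (0 < n)%N.
  case: n beta F hF F0 bn => // beta F _ _; rewrite mdegE big_ord0 //.
have eb : (e <= mdeg beta)%N by nia.
have [N0 HN0] := homogeneous_nullstellensatz iota_inj hF F0.
pose N := maxn N0 (mdeg beta).+1.
have [A HA] := choice (HN0 N (leq_maxl _ _)).
have bN : (mdeg beta < N)%N by rewrite leq_max leqnn orbT.
have [q Hq] := macaulay_bound hF (fun i => (HA i).1) (leq_trans eb (ltnW bN))
  (fun i => (HA i).2) bn bN e0.
(* Only the component of the right degree of each quotient is kept: the later order and norm
   estimates need homogeneous quotients. *)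
exists (fun k => pihomog mdeg (mdeg beta - e) (q k)); split=> [k|]; first exact: pihomogP.
have := congr1 (pihomog mdeg (mdeg beta)) Hq.
rewrite pihomogX eqxx linear_sum => ->; apply: eq_bigr => k _.
by rewrite -(pihomogM_homog _ _ (hF k)) subnK.
Qed.

(** * Orders and norms of convergent power series *)

Section OrderNorm.
Variables (K : numFieldType) (n : nat).
Local Notation O := (convps K n).
Local Notation S := {mpoly K[n]}.
Implicit Types (a b : O) (r M : K).

Definition ord_ge k a := forall m, (mdeg m < k)%N -> pscoef a m = 0.

(** A bound on the weighted l^1 norm at radius r. The norm itself is a supremum that need not exist
    in K, so bounds are carried instead. *)
Definition norm_le r M a :=
  forall N, \sum_(m : 'X_{1..n < N}) `|pscoef a m| * r ^+ mdeg m <= M.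

Lemma convps_eq a b : (forall m, pscoef a m = pscoef b m) -> a = b.
Proof. by move=> ab; apply/pscoef_inj/funext. Qed.

Lemma pscoefD a b m : pscoef (a + b) m = pscoef a m + pscoef b m.
Proof. by []. Qed.

Lemma pscoefN a m : pscoef (- a) m = - pscoef a m.
Proof. by []. Qed.

Lemma pscoefB a b m : pscoef (a - b) m = pscoef a m - pscoef b m.
Proof. by []. Qed.

Lemma pscoefZ c a m : pscoef (c *: a) m = c * pscoef a m.
Proof. by []. Qed.

Lemma pscoef0 m : pscoef (0 : O) m = 0.
Proof. by []. Qed.

Lemma pscoefM N a b m : (mdeg m < N)%N ->
  pscoef (a * b) m = (trunc N (pscoef a) * trunc N (pscoef b))@_m.
Proof. exact: ps_mul_trunc. Qed.

Lemma trunc_coef_ge N (c : 'X_{1..n} -> K) m : (N <= mdeg m)%N -> (trunc N c)@_m = 0.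
Proof.
move=> Nm; rewrite raddf_sum big1 //= => k _; rewrite mcoeffZ mcoeffX.
by case: eqP => [km|_]; rewrite ?mulr0 //; have := bmdeg k; rewrite km ltnNge Nm.
Qed.

Lemma ord_geP N a : ord_ge N a <-> trunc N (pscoef a) = 0.
Proof.
split=> [h|h m mN]; last by rewrite -(trunc_coef (pscoef a) mN) h mcoeff0.
by rewrite /trunc big1 // => m _; rewrite h ?scale0r ?bmdeg.
Qed.

Lemma ord_ge_all0 a : (forall k, ord_ge k a) -> a = 0.
Proof. by move=> h; apply: convps_eq => m; apply: (h (mdeg m).+1). Qed.

Lemma ord_geW k l a : (k <= l)%N -> ord_ge l a -> ord_ge k a.
Proof. by move=> kl h m mk; apply: h; apply: leq_trans kl. Qed.

Lemma ord_ge0 k : ord_ge k 0.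
Proof. by []. Qed.

Lemma ord_geD k a b : ord_ge k a -> ord_ge k b -> ord_ge k (a + b).
Proof. by move=> ha hb m mk; rewrite pscoefD ha // hb // addr0. Qed.

Lemma ord_geN k a : ord_ge k a -> ord_ge k (- a).
Proof. by move=> ha m mk; rewrite pscoefN ha // oppr0. Qed.

Lemma ord_geB k a b : ord_ge k a -> ord_ge k b -> ord_ge k (a - b).
Proof. by move=> ha hb; apply: ord_geD => //; apply: ord_geN. Qed.

Lemma ord_geBC k a b : ord_ge k (a - b) -> ord_ge k (b - a).
Proof. by move=> /ord_geN; rewrite opprB. Qed.

Lemma ord_ge_trans k b a c : ord_ge k (a - b) -> ord_ge k (b - c) -> ord_ge k (a - c).
Proof. by move=> ab bc; rewrite -(subrKA b); apply: ord_geD. Qed.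

Lemma ord_geZ k c a : ord_ge k a -> ord_ge k (c *: a).
Proof. by move=> ha m mk; rewrite pscoefZ ha // mulr0. Qed.

Lemma ord_ge_sum k (J : Type) (s : seq J) (P : pred J) (F : J -> O) :
  (forall j, P j -> ord_ge k (F j)) -> ord_ge k (\sum_(j <- s | P j) F j).
Proof.
by move=> h; elim/big_ind: _ => // a b; apply: ord_geD.
Qed.

Lemma ord_geM k l a b : ord_ge k a -> ord_ge l b -> ord_ge (k + l) (a * b).
Proof.
move=> ha hb m mkl; rewrite /= /ps_mul big1 // => -[p q] /= /eqP mpq.
have [pk|kp] := ltnP (mdeg p) k; first by rewrite ha ?mul0r.
rewrite hb ?mulr0 // -(ltn_add2l k); apply: leq_ltn_trans mkl.
have mE := congr1 mdeg mpq; rewrite mdegD in mE.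
by apply: leq_trans (eq_leq (esym mE)); rewrite leq_add2r.
Qed.

Lemma norm_leW r M M' a : M <= M' -> norm_le r M a -> norm_le r M' a.
Proof. by move=> MM h N; apply: le_trans MM. Qed.

Lemma norm_le_ge0 r M a : norm_le r M a -> 0 <= M.
Proof. by move=> /(_ 0%N); rewrite big1 // => -[m hm]; exfalso. Qed.

Lemma norm_le0 r : norm_le r 0 0.
Proof. by move=> N; rewrite big1 // => m _; rewrite pscoef0 normr0 mul0r. Qed.

Lemma norm_leD r M M' a b : 0 <= r -> norm_le r M a -> norm_le r M' b ->
  norm_le r (M + M') (a + b).
Proof.
move=> r0 ha hb N; apply: le_trans (lerD (ha N) (hb N)).
rewrite -big_split /=; apply: ler_sum => m _.
by rewrite -mulrDl; apply: ler_wpM2r; [rewrite exprn_ge0 | exact: ler_normD].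
Qed.

Lemma norm_leZ r M c a : norm_le r M a -> norm_le r (`|c| * M) (c *: a).
Proof.
move=> ha N; apply: le_trans (ler_wpM2l (normr_ge0 c) (ha N)).
by rewrite mulr_sumr; apply: ler_sum => m _; rewrite pscoefZ normrM mulrA.
Qed.

Lemma norm_leN r M a : norm_le r M a -> norm_le r M (- a).
Proof. by move=> /(norm_leZ (-1)); rewrite normrN1 mul1r scaleN1r. Qed.

Lemma norm_leB r M M' a b : 0 <= r -> norm_le r M a -> norm_le r M' b ->
  norm_le r (M + M') (a - b).
Proof. by move=> r0 ha hb; apply: norm_leD => //; apply: norm_leN. Qed.

Lemma norm_le_sum r (J : Type) (s : seq J) (P : pred J) (F : J -> O) (B : J -> K) :
  0 <= r -> (forall j, P j -> norm_le r (B j) (F j)) ->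
  norm_le r (\sum_(j <- s | P j) B j) (\sum_(j <- s | P j) F j).
Proof.
move=> r0 h; elim/big_ind2: _ => //; first exact: norm_le0.
by move=> M a M' b; apply: norm_leD.
Qed.

Lemma norm_leM r M M' a b : 0 <= r -> norm_le r M a -> norm_le r M' b ->
  norm_le r (M * M') (a * b).
Proof.
move=> r0 ha hb N.
pose F (c : O) (m : 'X_{1..n}) : K := `|pscoef c m| * r ^+ mdeg m.
have F0 c m : 0 <= F c m by rewrite mulr_ge0 // exprn_ge0.
have S0 c (J : nat) : 0 <= \sum_(m : 'X_{1..n < J}) F c m.
  by apply: sumr_ge0 => m _; apply: F0.
apply: le_trans (ler_pM (S0 _ _) (S0 _ _) (ha N) (hb N)).
rewrite big_distrlr /= pair_big /=.
apply: (@le_trans _ _ (\sum_(m : 'X_{1..n < N})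
    \sum_(k : 'X_{1..n < N, N} | (m : 'X_{1..n}) == (k.1 + k.2)%MM)
      F a k.1 * F b k.2)).
  apply: ler_sum => m _; rewrite (ps_mul_widen _ _ (bmdeg m)).
  apply: le_trans (ler_wpM2r _ (ler_norm_sum _ _ _)) _; first by rewrite exprn_ge0.
  rewrite mulr_suml; apply: ler_sum => k /eqP ->.
  by rewrite mdegD exprD normrM mulrACA.
rewrite (exchange_big_dep predT) //=; apply: ler_sum => k _.
case: (pickP (fun m : 'X_{1..n < N} => (m : 'X_{1..n}) == (k.1 + k.2)%MM)).
  move=> m0 h0; rewrite (big_pred1 m0) // => m /=.
  by rewrite bmeqP (eqP h0).
by move=> h; rewrite big_pred0 //; apply: mulr_ge0; apply: F0.
Qed.

(** Terms of degree i are scaled by t^i, hence by at most t^k: high order becomes smallness on a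
    smaller polydisc. *)
Lemma norm_le_shrink k r M t a : 0 <= r -> 0 <= t -> t <= 1 -> ord_ge k a ->
  norm_le r M a -> norm_le (t * r) (t ^+ k * M) a.
Proof.
move=> r0 t0 t1 ak h N; apply: le_trans (ler_wpM2l _ (h N)); last exact: exprn_ge0.
rewrite mulr_sumr; apply: ler_sum => m _.
have [mk|km] := ltnP (mdeg m) k; first by rewrite ak // normr0 !mul0r mulr0.
rewrite mulrCA; apply: ler_wpM2l => //; rewrite exprMn; apply: ler_wpM2r.
  exact: exprn_ge0.
by rewrite -(subnK km) exprD ler_piMl ?exprn_ge0 // exprn_ile1.
Qed.

Lemma pscoef_of_mpoly (p : S) m : pscoef (ps_of_mpoly p) m = p@_m.
Proof. by []. Qed.

Lemma convps_norm_le a : exists r M, 0 < r /\ norm_le r M a.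
Proof. exact: pscoef_conv. Qed.

End OrderNorm.

Section OfMpoly.
Variables (K : numFieldType) (n : nat).
Local Notation O := (convps K n).
Local Notation S := {mpoly K[n]}.

Fact ps_of_mpoly_zmod : zmod_morphism (@ps_of_mpoly K n).
Proof. by move=> p q; apply: convps_eq => m; rewrite pscoefB !pscoef_of_mpoly mcoeffB. Qed.

Fact ps_of_mpoly_monoid : monoid_morphism (@ps_of_mpoly K n).
Proof.
split=> [|p q]; apply: convps_eq => m; first by rewrite pscoef_of_mpoly mcoeff1.
by rewrite pscoef_of_mpoly mcoeffM.
Qed.

Fact ps_of_mpoly_scalable : scalable (@ps_of_mpoly K n).
Proof. by move=> c p; apply: convps_eq => m; rewrite pscoefZ !pscoef_of_mpoly mcoeffZ. Qed.

HB.instance Definition _ := GRing.isZmodMorphism.Build S O (@ps_of_mpoly K n) ps_of_mpoly_zmod.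
HB.instance Definition _ := GRing.isMonoidMorphism.Build S O (@ps_of_mpoly K n) ps_of_mpoly_monoid.
HB.instance Definition _ := GRing.isScalable.Build K S O *:%R (@ps_of_mpoly K n) ps_of_mpoly_scalable.

Definition psX (i : 'I_n) : O := ps_of_mpoly 'X_i.

Definition ps_eval (u : 'I_n -> O) : S -> O := mmap (GRing.in_alg O) u.
HB.instance Definition _ u := GRing.RMorphism.on (ps_eval u).

Fact ps_eval_scalable u : scalable (ps_eval u).
Proof. by move=> c p; rewrite /ps_eval mmapZ /= mulr_algl. Qed.
HB.instance Definition _ u := GRing.isScalable.Build K S O *:%R (ps_eval u) (ps_eval_scalable u).

Lemma ps_evalX u m : ps_eval u 'X_[m] = mmap1 u m.
Proof. by rewrite /ps_eval mmapX. Qed.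

Lemma ps_evalXU u i : ps_eval u 'X_i = u i.
Proof. by rewrite ps_evalX mmap1U. Qed.

Lemma lrmorph_mpolyE (A : comAlgType K) (phi psi : {lrmorphism S -> A}) (p : S) :
  (forall i, phi 'X_i = psi 'X_i) -> phi p = psi p.
Proof.
move=> h; rewrite [p]mpolyE !linear_sum; apply: eq_bigr => m _; rewrite !linearZ /=.
by rewrite !mpolyXE_id !rmorph_prod; congr (_ *: _); apply: eq_bigr => i _; rewrite !rmorphXn /= h.
Qed.

Lemma ps_eval_psX (p : S) : ps_eval psX p = ps_of_mpoly p.
Proof. by apply: lrmorph_mpolyE => i; rewrite /= ps_evalXU. Qed.

Lemma ps_evalE u (p : S) : ps_eval u p = \sum_(m <- msupp p) p@_m *: mmap1 u m.
Proof. by apply: eq_bigr => m _; rewrite /= mulr_algl. Qed.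

Lemma ps_eval_trunc u a N :
  ps_eval u (trunc N a) = \sum_(m : 'X_{1..n < N}) a m *: mmap1 u m.
Proof.
by rewrite linear_sum; apply: eq_bigr => m _; rewrite linearZ /= ps_evalX.
Qed.

Lemma mmap1S (u : 'I_n -> O) i m : mmap1 u (U_(i) + m)%MM = u i * mmap1 u m.
Proof. by rewrite -!ps_evalX mpolyXD rmorphM /= ps_evalXU. Qed.

Lemma ord_ge_psX i : ord_ge 1 (psX i).
Proof.
move=> m; rewrite ltnS leqn0 mdeg_eq0 => /eqP ->.
by rewrite pscoef_of_mpoly mcoeffX mnm1_eq0.
Qed.

Lemma ord_ge_of_mpoly k (p : S) : p \is k.-homog -> ord_ge k (ps_of_mpoly p).
Proof.
by move=> hp m mk; rewrite pscoef_of_mpoly (dhomog_nemf_coeff hp) // neq_ltn mk.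
Qed.

Lemma norm_le_of_mpoly k r (p : S) : 0 <= r -> p \is k.-homog ->
  norm_le r ((\sum_(m <- msupp p) `|p@_m|) * r ^+ k) (ps_of_mpoly p).
Proof.
move=> r0 /dhomogP hp; rewrite -ps_eval_psX ps_evalE mulr_suml big_seq [X in norm_le _ _ X]big_seq.
apply: norm_le_sum => // m /hp /= <-; apply: norm_leZ => N.
rewrite -ps_evalX ps_eval_psX.
have [mN|mN] := ltnP (mdeg m) N.
  rewrite (bigD1 (BMultinom mN)) //= mcoeffX eqxx normr1 mul1r big1 ?addr0 // => k'.
  by rewrite bmeqP /= mcoeffX eq_sym => /negPf ->; rewrite normr0 mul0r.
rewrite big1 ?exprn_ge0 // => k' _; rewrite pscoef_of_mpoly mcoeffX; case: eqP => [mk|_].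
  by have := bmdeg k'; rewrite -mk ltnNge mN.
by rewrite normr0 mul0r.
Qed.

Lemma norm_le_psX r i : 0 <= r -> norm_le r r (psX i).
Proof.
move=> r0; have hX : ('X_i : S) \is 1.-homog by rewrite dhomogX /= mdeg1.
by have := norm_le_of_mpoly r0 hX; rewrite msuppX big_seq1 mcoeffX eqxx normr1 mul1r.
Qed.

Lemma ord_ge_mmap1 (u : 'I_n -> O) m : (forall i, ord_ge 1 (u i)) -> ord_ge (mdeg m) (mmap1 u m).
Proof.
move=> hu; elim/mnm_ind: m => [|m i IH]; first by rewrite mdeg0.
by rewrite mmap1S mdegD mdeg1; apply: ord_geM.
Qed.

(** Replacing one factor at a time, each term has one factor of order d and |m| - 1 factors of order
    at least 1. *)
Lemma ord_ge_mmap1B (u u' : 'I_n -> O) d m :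
  (forall i, ord_ge 1 (u i)) -> (forall i, ord_ge 1 (u' i)) ->
  (forall i, ord_ge d (u i - u' i)) ->
  ord_ge (d + (mdeg m).-1) (mmap1 u m - mmap1 u' m).
Proof.
move=> hu hu' hd; elim/mnm_ind: m => [|m i IH]; first by rewrite !mmap11 subrr.
rewrite !mmap1S mdegD mdeg1 /=.
have -> : u i * mmap1 u m - u' i * mmap1 u' m =
  u i * (mmap1 u m - mmap1 u' m) + (u i - u' i) * mmap1 u' m by ring.
apply: ord_geD; last by apply: ord_geM => //; apply: ord_ge_mmap1.
by apply: ord_geW (ord_geM (hu i) IH); lia.
Qed.

Lemma norm_le_mmap1 r M (u : 'I_n -> O) m : 0 <= r -> (forall i, norm_le r M (u i)) ->
  norm_le r (M ^+ mdeg m) (mmap1 u m).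
Proof.
move=> r0 hu; elim/mnm_ind: m => [|m i IH].
  have := norm_le_of_mpoly r0 (dhomog1 K (mdeg : measure n)).
  by rewrite mmap11 mdeg0 rmorph1 msupp1 big_seq1 mcoeff1 eqxx normr1 mul1r.
by rewrite mmap1S mdegD mdeg1 exprS; apply: norm_leM.
Qed.

End OfMpoly.

(** * Substitutions *)

Section FixedPoint.
Variables (K : numFieldType) (n : nat).
Local Notation O := (convps K n).

(* No completeness is needed: the coefficients of the iterates of 0 are eventually
   constant, and the uniform norm bound makes the limit convergent. *)
Lemma ord_fixpoint (J : Type) (k : nat) (r M : K) (T : (J -> O) -> (J -> O)) :
  0 < r -> 0 <= M ->
  let B (xi : J -> O) := forall j, ord_ge k (xi j) /\ norm_le r M (xi j) in
  (forall xi, B xi -> B (T xi)) ->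
  (forall d xi xi', B xi -> B xi' -> (forall j, ord_ge d (xi j - xi' j)) ->
     forall j, ord_ge d.+1 (T xi j - T xi' j)) ->
  exists2 xi, B xi & forall j, T xi j = xi j.
Proof.
move=> r0 M0 B TB Tcontr.
pose s l : J -> O := iter l T (fun=> 0).
have Bs l : B (s l).
  elim: l => [|l IH]; last exact: TB.
  by move=> j; split; [exact: ord_ge0 | apply: norm_leW M0 _; apply: norm_le0].
have sS l : forall j, ord_ge l (s l j - s l.+1 j).
  elim: l => [j m //|l IH]; exact: (Tcontr l _ _ (Bs l) (Bs l.+1) IH).
have sD l i j : ord_ge l (s l j - s (l + i)%N j).
  elim: i => [|i IH]; first by rewrite addn0 subrr.
  rewrite addnS; apply: ord_ge_trans IH _.
  by apply: ord_geW (sS _ j); rewrite leq_addr.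
have s_eq l i j m : (mdeg m < l)%N -> (l <= i)%N -> pscoef (s i j) m = pscoef (s l j) m.
  move=> ml li; apply/eqP; rewrite -subr_eq0 -opprB oppr_eq0 -pscoefB.
  by rewrite -(subnKC li) sD.
pose lim j m := pscoef (s (mdeg m).+1 j) m.
have limN j N : \sum_(m : 'X_{1..n < N}) `|lim j m| * r ^+ mdeg m <= M.
  have [_ /(_ N)] := Bs N j; congr (_ <= _); apply: eq_bigr => m _.
  by congr (`|_| * _); apply: s_eq; rewrite ?bmdeg.
have limc j : convergent (lim j) by exists r, M.
pose xi j : O := mkps (limc j).
have xi_s l j : ord_ge l (s l j - xi j).
  move=> m ml; have xiE : pscoef (xi j) m = pscoef (s (mdeg m).+1 j) m by [].
  by rewrite pscoefB xiE (s_eq (mdeg m).+1) // subrr.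
have Bxi : B xi.
  move=> j; split=> [m mk|N]; last exact: limN.
  by have [+ _] := Bs (mdeg m).+1 j; apply.
exists xi => // j; apply/eqP; rewrite -subr_eq0; apply/eqP.
apply: ord_ge_all0 => l; apply: (ord_geW (leqnSn l)).
apply: (@ord_ge_trans _ _ _ (s l.+1 j)); last exact: xi_s.
by apply: ord_geBC; apply: Tcontr => // i; apply: xi_s.
Qed.

End FixedPoint.

Section Substitution.
Variables (K : numFieldType) (n : nat).
Local Notation O := (convps K n).
Local Notation S := {mpoly K[n]}.
Implicit Types (a b : O) (u : 'I_n -> O).

Lemma ord_ge_ps_eval u k (p : S) : (forall i, ord_ge 1 (u i)) ->
  (forall m, (mdeg m < k)%N -> p@_m = 0) -> ord_ge k (ps_eval u p).
Proof.
move=> hu hp; rewrite ps_evalE big_seq; apply: ord_ge_sum => m.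
rewrite mcoeff_msupp => pm; apply: ord_geZ; apply: ord_geW (ord_ge_mmap1 hu).
by rewrite leqNgt; apply: contraNN pm => /hp ->.
Qed.

Lemma ord_ge_ps_evalB u u' d (p : S) :
  (forall i, ord_ge 1 (u i)) -> (forall i, ord_ge 1 (u' i)) ->
  (forall i, ord_ge d (u i - u' i)) ->
  (forall m, (mdeg m < 2)%N -> p@_m = 0) -> ord_ge d.+1 (ps_eval u p - ps_eval u' p).
Proof.
move=> hu hu' hd hp; rewrite !ps_evalE -sumrB big_seq; apply: ord_ge_sum => m.
rewrite mcoeff_msupp -scalerBr => pm; apply: ord_geZ.
apply: ord_geW (ord_ge_mmap1B hu hu' hd).
have : (1 < mdeg m)%N by rewrite ltnNge -ltnS; apply: contraNN pm => /hp ->.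
lia.
Qed.

Lemma norm_le_ps_eval_trunc r rho M u a N : 0 <= r ->
  (forall i, norm_le r rho (u i)) -> norm_le rho M a ->
  norm_le r M (ps_eval u (trunc N (pscoef a))).
Proof.
move=> r0 hu ha; rewrite ps_eval_trunc; apply: norm_leW (ha N) _.
by apply: norm_le_sum => // m _; apply: norm_leZ; apply: norm_le_mmap1.
Qed.

(** The composite a(u), characterized order by order through truncations instead of an infinite sum.
    The laws of substitution then reduce to those of polynomial evaluation. *)
Definition is_subst u a b :=
  forall N, ord_ge N (b - ps_eval u (trunc N (pscoef a))).

Lemma is_subst_uniq u a b b' : is_subst u a b -> is_subst u a b' -> b = b'.
Proof.
move=> hb hb'; apply/eqP; rewrite -subr_eq0; apply/eqP/ord_ge_all0 => N.
by apply: ord_ge_trans (hb N) _; apply: ord_geBC.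
Qed.

Lemma subst_trunc u a N N' : (forall i, ord_ge 1 (u i)) -> (N <= N')%N ->
  ord_ge N (ps_eval u (trunc N' (pscoef a)) - ps_eval u (trunc N (pscoef a))).
Proof.
move=> hu NN'; rewrite -rmorphB; apply: ord_ge_ps_eval => // m mN.
by rewrite mcoeffB !trunc_coef ?subrr // (leq_trans mN).
Qed.

Lemma is_subst_ord u a b k : (forall i, ord_ge 1 (u i)) -> ord_ge k a ->
  is_subst u a b -> ord_ge k b.
Proof. by move=> hu /ord_geP ak /(_ k); rewrite ak rmorph0 subr0. Qed.

Lemma is_subst_norm r rho M u a b : 0 <= r ->
  (forall i, norm_le r rho (u i)) -> norm_le rho M a -> is_subst u a b -> norm_le r M b.
Proof.
move=> r0 hu ha hb N; have := norm_le_ps_eval_trunc N r0 hu ha N.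
congr (_ <= _); apply: eq_bigr => m _; congr (`|_| * _); apply/eqP.
by rewrite eq_sym -subr_eq0 -pscoefB hb ?bmdeg.
Qed.

Lemma common_radius u : exists r M, 0 < r /\ forall i, norm_le r M (u i).
Proof.
have H i : exists p : K * K, 0 < p.1 /\ norm_le p.1 p.2 (u i).
  by have [r [M h]] := convps_norm_le (u i); exists (r, M).
have [p Hp] := choice H.
have pi0 i : 0 <= (p i).1^-1 by rewrite invr_ge0 ltW // (Hp i).1.
have s0 : 0 < 1 + \sum_i (p i).1^-1 by rewrite ltr_pwDl // sumr_ge0.
(* The reciprocal of a sum of reciprocals lies below every radius without any comparison between
   them. *)
exists (1 + \sum_i (p i).1^-1)^-1, (\sum_i (p i).2); split=> [|i]; first by rewrite invr_gt0.
have [pi_gt0 hi] := Hp i.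
apply: (@norm_leW _ _ _ (p i).2).
  by rewrite (bigD1 i) //= lerDl sumr_ge0 // => j _; apply: norm_le_ge0 (Hp j).2.
apply: (convergentW (r := (p i).1)) => //; first by rewrite invr_gt0.
rewrite -[leRHS]invrK lef_pV2 ?posrE ?invr_gt0 //.
rewrite (bigD1 i) //= addrCA lerDl addr_ge0 // sumr_ge0 //.
Qed.

(* Since u vanishes at 0, shrinking the radius brings the norms of the u i below the
   radius of convergence of a. *)
Lemma is_subst_exists u a : (forall i, ord_ge 1 (u i)) -> exists b, is_subst u a b.
Proof.
move=> hu; have [r [M [r0 hM]]] := common_radius u.
have [r' [M' [r'0 ha]]] := convps_norm_le a.
(* The absolute value covers n = 0, where no [u i] forces M to be nonnegative. *)
have Mp : 0 <= `|M| / r' by rewrite mulr_ge0 // invr_ge0 ltW.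
pose t := (1 + `|M| / r')^-1.
have t0 : 0 < t by rewrite invr_gt0 ltr_pwDl.
have t1 : t <= 1 by rewrite invf_le1 ?ltr_pwDl // lerDl.
have hMt i : norm_le (t * r) r' (u i).
  apply: norm_leW (norm_le_shrink (ltW r0) (ltW t0) t1 (hu i) (hM i)).
  rewrite expr1 /t mulrC ler_pdivrMr ?ltr_pwDl // mulrDr mulr1 mulrCA divff ?gt_eqF // mulr1.
  have M0 : 0 <= M by apply: norm_le_ge0 (hM i).
  by rewrite ger0_norm // lerDr ltW.
have tr0 : 0 < t * r by rewrite mulr_gt0.
pose c m := pscoef (ps_eval u (trunc (mdeg m).+1 (pscoef a))) m.
have cN N (m : 'X_{1..n}) : (mdeg m < N)%N ->
    c m = pscoef (ps_eval u (trunc N (pscoef a))) m.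
  move=> mN; apply/eqP; rewrite eq_sym -subr_eq0 -pscoefB.
  by rewrite (@subst_trunc u a (mdeg m).+1 N).
have cc : convergent c.
  exists (t * r), M'; split=> // N.
  have := norm_le_ps_eval_trunc N (ltW tr0) hMt ha N.
  by congr (_ <= _); apply: eq_bigr => m _; rewrite (cN N) ?bmdeg.
exists (mkps cc) => N m mN.
by rewrite pscoefB /= (cN N) // subrr.
Qed.

Lemma substitution u : (forall i, ord_ge 1 (u i)) ->
  exists phi : {lrmorphism O -> O}, forall a, is_subst u a (phi a).
Proof.
move=> hu; have [phi Hphi] := choice (fun a => is_subst_exists a hu).
have phiZ : zmod_morphism phi.
  move=> a b; apply: (is_subst_uniq (Hphi _)) => N.
  have -> : trunc N (pscoef (a - b)) = trunc N (pscoef a) - trunc N (pscoef b).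
    by rewrite /trunc -sumrB; apply: eq_bigr => m _; rewrite pscoefB scalerBl.
  rewrite rmorphB /=; set A := ps_eval u _; set B := ps_eval u _.
  have -> : phi a - phi b - (A - B) = (phi a - A) - (phi b - B) by ring.
  by apply: ord_geB; apply: Hphi.
have phiM : monoid_morphism phi.
  split=> [|a b]; apply: (is_subst_uniq (Hphi _)) => N.
    have : ord_ge N (ps_eval u (1 - trunc N (pscoef (1 : O)))).
      apply: ord_ge_ps_eval => // m mN.
      by rewrite mcoeffB trunc_coef // mcoeff1 subrr.
    by rewrite rmorphB rmorph1.
  have hN : ord_ge N (ps_eval u (trunc N (pscoef a) * trunc N (pscoef b) - trunc N (pscoef (a * b)))).
    apply: ord_ge_ps_eval => // m mN.
    by rewrite mcoeffB trunc_coef // (pscoefM _ _ mN) subrr.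
  rewrite rmorphB rmorphM /= in hN; apply: ord_ge_trans hN.
  set A := ps_eval u _; set B := ps_eval u _.
  have -> : phi a * phi b - A * B = (phi a - A) * phi b + A * (phi b - B) by ring.
  apply: ord_geD; first by rewrite -(addn0 N); apply: ord_geM => //; apply: Hphi.
  by rewrite -(add0n N); apply: ord_geM => //; apply: Hphi.
have phiS : scalable phi.
  move=> c a; apply: (is_subst_uniq (Hphi _)) => N.
  have -> : trunc N (pscoef (c *: a)) = c *: trunc N (pscoef a).
    by rewrite /trunc scaler_sumr; apply: eq_bigr => m _; rewrite pscoefZ scalerA.
  by rewrite linearZ /= -scalerBr; apply: ord_geZ; apply: Hphi.
pose zM := GRing.isZmodMorphism.Build O O phi phiZ.
pose mM := GRing.isMonoidMorphism.Build O O phi phiM.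
pose sM := GRing.isScalable.Build K O O *:%R phi phiS.
pose Phi : {lrmorphism O -> O} := HB.pack phi zM mM sM.
by exists Phi.
Qed.

Lemma subst_of_mpoly u a (p : S) : (forall i, ord_ge 1 (u i)) ->
  is_subst u (ps_of_mpoly p) a -> a = ps_eval u p.
Proof.
move=> hu ha; apply: (is_subst_uniq ha) => N.
rewrite -rmorphB; apply: ord_ge_ps_eval => // m mN.
by rewrite mcoeffB trunc_coef // pscoef_of_mpoly subrr.
Qed.

(** Up to order N a series may be replaced by its truncation, and on polynomials the composite is
    determined by the images of the variables. *)
Lemma subst_left_inverse u v (phi psi : {lrmorphism O -> O}) :
  (forall i, ord_ge 1 (v i)) ->
  (forall a, is_subst u a (phi a)) -> (forall a, is_subst v a (psi a)) ->
  (forall i, psi (u i) = psX K i) -> cancel phi psi.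
Proof.
move=> hv hphi hpsi psiu a; apply/eqP; rewrite -subr_eq0; apply/eqP/ord_ge_all0 => N.
apply: (@ord_ge_trans _ _ _ (psi (ps_eval u (trunc N (pscoef a))))).
  rewrite -rmorphB; apply: is_subst_ord (hpsi _) => //; exact: hphi.
have -> : psi (ps_eval u (trunc N (pscoef a))) = ps_of_mpoly (trunc N (pscoef a)).
  apply: (lrmorph_mpolyE (phi := psi \o ps_eval u)) => i.
  by rewrite /= ps_evalXU psiu.
by move=> m mN; rewrite pscoefB pscoef_of_mpoly trunc_coef // subrr.
Qed.

Lemma shifted_ord1 (xi : 'I_n -> O) : (forall i, ord_ge 2 (xi i)) ->
  forall i, ord_ge 1 (psX K i + xi i).
Proof. by move=> h i; apply: ord_geD; [exact: ord_ge_psX | apply: ord_geW (h i)]. Qed.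

(* zeta is a fixed point of zeta |-> - eta(x + zeta). *)
Lemma tangent_identity_left_inverse (eta : 'I_n -> O) : (forall i, ord_ge 2 (eta i)) ->
  exists2 zeta : 'I_n -> O, (forall i, ord_ge 2 (zeta i)) &
    forall i a, is_subst (fun j => psX K j + zeta j) (eta i) a -> zeta i = - a.
Proof.
move=> heta.
(* The fixed point argument iterates a total map, so T gets the default value 0 where zeta has too
   small an order. *)
have HT0 (zeta : 'I_n -> O) : exists b : 'I_n -> O, (forall i, ord_ge 2 (zeta i)) ->
    forall i, is_subst (fun j => psX K j + zeta j) (eta i) (- b i).
  have [hz|nhz] := pselect (forall i, ord_ge 2 (zeta i)); last by exists (fun=> 0).
  have [b hb] := choice (fun i => is_subst_exists (eta i) (shifted_ord1 hz)).
  by exists (fun i => - b i) => _ i; rewrite opprK.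
have [T HT] := choice HT0.
have [r0 [M [r0_gt0 hM]]] := common_radius eta.
(* With zeta of norm at most r, x + zeta has norm at most r + r, so that
   zeta |-> - eta(x + zeta) maps the ball of radius r to itself. *)
have [r [r_gt0 hr]] : exists r, 0 < r /\ forall i, norm_le (r + r) r (eta i).
  have M0 : 0 <= `|M| / r0 by rewrite mulr_ge0 // invr_ge0 ltW.
  (* Order 2 gives eta norm t^2 M at radius t r0; this t brings it below t r0 / 2. *)
  pose t := (1 + 2%:R * (`|M| / r0))^-1.
  have s0 : 0 < 1 + 2%:R * (`|M| / r0) by rewrite ltr_pwDl // mulr_ge0.
  have t0 : 0 < t by rewrite invr_gt0.
  have t1 : t <= 1 by rewrite invf_le1 // lerDl mulr_ge0.
  exists (t * r0 / 2%:R); split=> [|i]; first by rewrite divr_gt0 // mulr_gt0.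
  rewrite -splitr; apply: norm_leW (norm_le_shrink (ltW r0_gt0) (ltW t0) t1 (heta i) (hM i)).
  rewrite expr2 -!mulrA ler_pM2l // /t ler_pdivrMl // ger0_norm ?(norm_le_ge0 (hM i)) //.
  have r0n : r0 != 0 by rewrite gt_eqF.
  have -> : (1 + 2%:R * (M / r0)) * (r0 / 2%:R) = r0 / 2%:R + M by field.
  by rewrite lerDr divr_ge0 // ltW.
have [||zeta Bz Hz] := @ord_fixpoint K n 'I_n 2 r r T r_gt0 (ltW r_gt0).
- move=> zeta Bz i; have hz j := (Bz j).1; split.
    by rewrite -[T _ _]opprK; apply/ord_geN/(is_subst_ord (shifted_ord1 hz) (heta i))/HT.
  rewrite -[T _ _]opprK; apply: norm_leN.
  apply: is_subst_norm (ltW r_gt0) _ (hr i) (HT _ hz i) => j.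
  by apply: norm_leD; rewrite ?(ltW r_gt0) //; [apply: norm_le_psX; apply: ltW | exact: (Bz j).2].
- move=> d zeta zeta' Bz Bz' hd i.
  have hz j := (Bz j).1; have hz' j := (Bz' j).1.
  have h1 := HT _ hz i d.+1; have h2 := HT _ hz' i d.+1.
  set P := ps_eval _ _ in h1; set P' := ps_eval _ _ in h2.
  have -> : T zeta i - T zeta' i = (- T zeta' i - P') - (- T zeta i - P) + (P' - P) by ring.
  apply: ord_geD; first exact: ord_geB.
  apply: ord_geBC.
  apply: ord_ge_ps_evalB => [|||m m2]; [exact: shifted_ord1|exact: shifted_ord1| |].
    by move=> j; rewrite opprD addrACA subrr add0r.
  have [md|md] := ltnP (mdeg m) d.+1; first by rewrite trunc_coef // heta.
  by rewrite trunc_coef_ge.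
exists zeta => [i|i a ha]; first exact: (Bz i).1.
by rewrite -Hz (is_subst_uniq ha (HT _ (fun j => (Bz j).1) i)) opprK.
Qed.

End Substitution.

Section TangentIdentity.
Variables (K : numFieldType) (n : nat).
Local Notation O := (convps K n).

(** The left inverse psi of phi is again tangent to the identity, so it has a left inverse theta.
    Then phi = theta, and psi is a two-sided inverse. *)
Lemma tangent_identity_automorphism (xi : 'I_n -> O) : (forall i, ord_ge 2 (xi i)) ->
  exists2 phi : {lrmorphism O -> O}, bijective phi &
    forall a, is_subst (fun j => psX K j + xi j) a (phi a).
Proof.
have step (eta : 'I_n -> O) (phi : {lrmorphism O -> O}) : (forall i, ord_ge 2 (eta i)) ->
    (forall a, is_subst (fun j => psX K j + eta j) a (phi a)) ->
    exists2 zeta : 'I_n -> O, (forall i, ord_ge 2 (zeta i)) &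
    exists2 psi : {lrmorphism O -> O}, cancel phi psi &
      forall a, is_subst (fun j => psX K j + zeta j) a (psi a).
  move=> heta hphi; have [zeta hz Hz] := tangent_identity_left_inverse heta.
  have [psi hpsi] := substitution (shifted_ord1 hz).
  exists zeta => //; exists psi => //.
  apply: (subst_left_inverse (shifted_ord1 hz) hphi hpsi) => i.
  rewrite rmorphD /= (subst_of_mpoly (shifted_ord1 hz) (hpsi _)) ps_evalXU.
  by rewrite (Hz i _ (hpsi _)) subrK.
move=> hxi; have [phi hphi] := substitution (shifted_ord1 hxi).
have [zeta hzeta [psi phiK hpsi]] := step _ _ hxi hphi.
have [_ _ [theta psiK _]] := step _ _ hzeta hpsi.
exists phi => //; exists psi => // b.
by rewrite -[phi _]psiK phiK psiK.
Qed.

End TangentIdentity.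

(** * Solving f(x + xi) = g *)

Section Taylor.
Variables (K : numFieldType) (n : nat).
Local Notation O := (convps K n).
Local Notation S := {mpoly K[n]}.
Implicit Types (xi : 'I_n -> O) (p f : S).

Local Notation shifted xi := (fun i => psX K i + xi i).

Definition taylor_rem xi (p : S) : O :=
  ps_eval (shifted xi) p - ps_of_mpoly p - \sum_k xi k * ps_of_mpoly p^`M(k).

Fact taylor_rem_linear xi : linear (taylor_rem xi).
Proof.
move=> c p q; rewrite /taylor_rem !linearP /= !scalerBr.
have -> : \sum_k xi k * ps_of_mpoly (c *: p + q)^`M(k) =
    c *: \sum_k xi k * ps_of_mpoly p^`M(k) + \sum_k xi k * ps_of_mpoly q^`M(k).
  rewrite scaler_sumr -big_split; apply: eq_bigr => k _ /=.
  by rewrite !linearP /= mulrDr scalerAr.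
by ring.
Qed.
HB.instance Definition _ xi := GRing.isLinear.Build K S O *:%R (taylor_rem xi)
  (taylor_rem_linear xi).

Lemma taylor_remE xi p :
  taylor_rem xi p = \sum_(m <- msupp p) p@_m *: taylor_rem xi 'X_[m].
Proof.
rewrite {1}[p]mpolyE linear_sum; apply: eq_bigr => m _; exact: linearZ.
Qed.

(** The first-order terms of the product rule cancel, leaving a recursion on monomials along which
    both estimates below are proved. *)
Lemma taylor_rem_mulX xi i p : taylor_rem xi ('X_i * p) =
  psX K i * taylor_rem xi p + xi i * (ps_eval (shifted xi) p - ps_of_mpoly p).
Proof.
rewrite /taylor_rem !rmorphM /= ps_evalXU -/(psX K i).
have -> : \sum_k xi k * ps_of_mpoly ('X_i * p)^`M(k) =
    xi i * ps_of_mpoly p + psX K i * \sum_k xi k * ps_of_mpoly p^`M(k).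
  rewrite mulr_sumr -[xi i * _](big_pred1_eq +%R i (fun k => xi k * ps_of_mpoly p)).
  rewrite big_mkcond -big_split; apply: eq_bigr => k _ /=.
  rewrite mderivM rmorphD !rmorphM /= mderivX mnm1E [k == i]eq_sym.
  case: eqP => [->|_]; last by rewrite scale0r rmorph0 mul0r !add0r -/(psX K i); ring.
  have -> : (U_(k) - U_(k))%MM = 0%MM :> 'X_{1..n} by apply/mnmP => j; rewrite mnmBE subnn mnm0E.
  by rewrite mpolyX0 scale1r rmorph1 -/(psX K k); ring.
by ring.
Qed.

Lemma taylor_rem1 xi : taylor_rem xi 1 = 0.
Proof.
rewrite /taylor_rem !rmorph1 subrr big1 ?subr0 // => k _.
by rewrite -mpolyC1 mderivC rmorph0 mulr0.
Qed.

Lemma taylor_rem0 p : taylor_rem (fun=> 0) p = 0.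
Proof.
rewrite /taylor_rem big1 => [|k _]; last by rewrite mul0r.
rewrite subr0; suff -> : ps_eval (fun i => psX K i + 0) p = ps_of_mpoly p by rewrite subrr.
by apply: lrmorph_mpolyE => i /=; rewrite ps_evalXU addr0.
Qed.

(** The remainder is quadratic in the shift: each term of the difference has a factor [xi - xi'] of
    order d, a second factor xi or xi' of order 2, and s - 2 factors of order at least 1. *)
Lemma ord_ge_taylor_remB s d xi xi' f : f \is s.-homog ->
  (forall i, ord_ge 2 (xi i)) -> (forall i, ord_ge 2 (xi' i)) ->
  (forall i, ord_ge d (xi i - xi' i)) -> ord_ge (d + s) (taylor_rem xi f - taylor_rem xi' f).
Proof.
move=> /dhomogP hf h h' hd.
rewrite !(taylor_remE _ f) -sumrB big_seq; apply: ord_ge_sum => m /hf /= <- {hf}.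
rewrite -scalerBr; apply: ord_geZ.
have hdX i : ord_ge d (psX K i + xi i - (psX K i + xi' i)).
  by rewrite opprD addrACA subrr add0r.
elim/mnm_ind: m => [|m i IH]; first by rewrite mpolyX0 !taylor_rem1 subrr.
rewrite mpolyXD !taylor_rem_mulX mdegD mdeg1 !ps_evalX.
set E := mmap1 _ m - _; set E' := mmap1 _ m - _.
set Q := taylor_rem _ _; set Q' := taylor_rem _ _.
have -> : psX K i * Q + xi i * E - (psX K i * Q' + xi' i * E') =
   psX K i * (Q - Q') + (xi i - xi' i) * E + xi' i * (E - E') by ring.
have hE : ord_ge (2 + (mdeg m).-1) E.
  rewrite /E -ps_eval_psX ps_evalX; apply: ord_ge_mmap1B => [||j].
  - exact: shifted_ord1.
  - exact: ord_ge_psX.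
  - by rewrite addrC addKr.
have hEE : ord_ge (d + (mdeg m).-1) (E - E').
  have -> : E - E' = mmap1 (shifted xi) m - mmap1 (shifted xi') m by rewrite /E /E'; ring.
  by apply: ord_ge_mmap1B => //; apply: shifted_ord1.
apply: ord_geD; first apply: ord_geD.
- by apply: ord_geW (ord_geM (ord_ge_psX _ i) IH); lia.
- by apply: ord_geW (ord_geM (hd i) hE); lia.
- by apply: ord_geW (ord_geM (h' i) hEE); lia.
Qed.

(** As eps <= 1, each x_j + xi_j has norm at most 2r, and two factors xi give eps^2. The doubling in
    2r accounts exactly for the two terms of the recursion. *)
Lemma norm_le_taylor_rem s r eps xi f : f \is s.-homog -> 0 <= r -> 0 <= eps -> eps <= 1 ->
  (forall i, norm_le r (eps * r) (xi i)) ->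
  norm_le r ((\sum_(m <- msupp f) `|f@_m|) * ((2%:R * r) ^+ s * eps ^+ 2)) (taylor_rem xi f).
Proof.
move=> /dhomogP hf r0 e0 e1 h.
rewrite taylor_remE mulr_suml big_seq [X in norm_le _ _ X]big_seq.
apply: norm_le_sum => // m /hf /= <- {hf}; apply: norm_leZ.
have hX j : norm_le r (2%:R * r) (psX K j + xi j).
  have -> : 2%:R * r = r + r by ring.
  apply: norm_leD => //; first exact: norm_le_psX.
  by apply: norm_leW (h j); rewrite ler_piMl.
have hE m' : norm_le r ((2%:R * r) ^+ mdeg m' * eps) (mmap1 (shifted xi) m' - ps_of_mpoly 'X_[m']).
  elim/mnm_ind: m' => [|m' i IH].
    rewrite mmap11 mpolyX0 rmorph1 subrr mdeg0 expr0 mul1r.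
    by apply: norm_leW (norm_le0 _ _).
  rewrite mmap1S mpolyXD rmorphM mdegD mdeg1 /= -/(psX K i).
  set u := mmap1 _ m' in IH *; set v := ps_of_mpoly _ in IH *.
  have -> : (psX K i + xi i) * u - psX K i * v = psX K i * (u - v) + xi i * u by ring.
  have -> : (2%:R * r) ^+ (1 + mdeg m') * eps =
     r * ((2%:R * r) ^+ mdeg m' * eps) + (eps * r) * (2%:R * r) ^+ mdeg m'.
    by rewrite exprD expr1; ring.
  apply: norm_leD => //; apply: norm_leM => //; first exact: norm_le_psX.
  exact: norm_le_mmap1.
elim/mnm_ind: m => [|m i IH].
  rewrite mpolyX0 taylor_rem1 mdeg0 expr0 mul1r.
  by apply: norm_leW (norm_le0 _ _); rewrite exprn_ge0.
rewrite mpolyXD taylor_rem_mulX mdegD mdeg1 ps_evalX.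
have -> : (2%:R * r) ^+ (1 + mdeg m) * eps ^+ 2 =
   r * ((2%:R * r) ^+ mdeg m * eps ^+ 2) + (eps * r) * ((2%:R * r) ^+ mdeg m * eps).
  by rewrite exprD expr1; ring.
by apply: norm_leD => //; apply: norm_leM => //; apply: norm_le_psX.
Qed.

End Taylor.

Section Division.
Variables (K : numFieldType) (n : nat).
Local Notation O := (convps K n).
Local Notation S := {mpoly K[n]}.
Implicit Types (a b : O).

Lemma sum_shift_le (G : 'X_{1..n} -> K) (al : 'X_{1..n}) N : (forall m, 0 <= G m) ->
  \sum_(m : 'X_{1..n < N}) G (m + al)%MM <= \sum_(m : 'X_{1..n < N + mdeg al}) G m.
Proof.
move=> G0; apply: (@le_trans _ _ (\sum_(m : 'X_{1..n < N})
    \sum_(k : 'X_{1..n < N + mdeg al} | (k : 'X_{1..n}) == (m + al)%MM) G k)).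
  apply: ler_sum => m _; have mN : (mdeg (m + al)%MM < N + mdeg al)%N.
    by rewrite mdegD ltn_add2r bmdeg.
  by rewrite (big_pred1 (BMultinom mN)) // => k /=; rewrite bmeqP.
rewrite (exchange_big_dep predT) //=; apply: ler_sum => k _.
case: (pickP (fun m : 'X_{1..n < N} => (k : 'X_{1..n}) == (m + al)%MM)) => [m0 /eqP h0|h].
  rewrite (big_pred1 m0) // => m /=.
  by rewrite h0 bmeqP eqm_add2r eq_sym.
by rewrite big_pred0.
Qed.

(** [sel] will pick the monomials whose chosen divisor is [al], so that no monomial is divided
    twice. *)
Lemma shift_exists (al : 'X_{1..n}) (sel : pred 'X_{1..n}) a : exists b : O,
  (forall m, pscoef b m = if sel (m + al)%MM then pscoef a (m + al)%MM else 0) /\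
  forall r M, 0 < r -> norm_le r M a -> norm_le r (M / r ^+ mdeg al) b.
Proof.
pose c m := if sel (m + al)%MM then pscoef a (m + al)%MM else 0.
have hc r M : 0 < r -> norm_le r M a -> forall N,
    \sum_(m : 'X_{1..n < N}) `|c m| * r ^+ mdeg m <= M / r ^+ mdeg al.
  move=> r0 ha N; rewrite ler_pdivlMr ?exprn_gt0 // mulr_suml.
  pose G m := `|pscoef a m| * r ^+ mdeg m.
  have G0 m : 0 <= G m by rewrite mulr_ge0 // exprn_ge0 // ltW.
  apply: le_trans (le_trans (sum_shift_le al N G0) (ha _)); apply: ler_sum => m _.
  rewrite /c; case: ifP => _; last by rewrite normr0 !mul0r.
  by rewrite /G mdegD exprD mulrA.
have [r [M [r0 ha]]] := convps_norm_le a.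
have cc : convergent c by exists r, (M / r ^+ mdeg al); split=> //; apply: hc.
by exists (mkps cc); split=> // r' M' r'0 ha'; apply: hc.
Qed.

Lemma pscoef_mulX a al m :
  pscoef (a * ps_of_mpoly 'X_[al]) m = if (al <= m)%MM then pscoef a (m - al)%MM else 0.
Proof.
rewrite (pscoefM (N := (mdeg m).+1)) //.
rewrite (mcoeffM_eq (p' := trunc (mdeg m).+1 (pscoef a)) (q' := 'X_[al])) => [||k km] //.
  rewrite mcoeff_mulX; case: ifP => // alm; rewrite trunc_coef //.
  by rewrite ltnS -{2}(submK alm) mdegD leq_addr.
by rewrite trunc_coef.
Qed.

Lemma mnm_sub_degree d (m : 'X_{1..n}) : (d <= mdeg m)%N ->
  exists al : 'X_{1..n}, (al <= m)%MM /\ mdeg al = d.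
Proof.
elim/mnm_ind: m => [|m i IH].
  by rewrite mdeg0 leqn0 => /eqP ->; exists 0%MM; rewrite mdeg0 lepm_refl.
rewrite mdegD mdeg1 add1n => dm; have [/IH[al [alm ald]]|md] := leqP d (mdeg m).
  by exists al; split=> //; apply: lepm_trans alm _; rewrite addmC lem_addr.
by exists (U_(i) + m)%MM; rewrite lepm_refl mdegD mdeg1 add1n; split=> //; lia.
Qed.

(* A monomial of degree at least d is divided through a chosen divisor A m of degree
   exactly d; this makes the operator bounded for all norms at once. *)
Lemma division_operator (d e : nat) (F : 'I_n -> S) : (e <= d)%N ->
  (forall al : 'X_{1..n}, mdeg al = d -> exists P : 'I_n -> S,
     (forall k, P k \is (d - e).-homog) /\ 'X_[al] = \sum_k P k * F k) ->
  exists L : O -> 'I_n -> O,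
  [/\ forall a b i, L (a - b) i = L a i - L b i,
      forall k a i, (d <= k)%N -> ord_ge k a -> ord_ge (k - e) (L a i),
      exists C, 0 <= C /\ forall r M a i, 0 < r -> norm_le r M a ->
        norm_le r (C * (M / r ^+ e)) (L a i) &
      forall a, ord_ge d a -> \sum_i L a i * ps_of_mpoly (F i) = a].
Proof.
move=> ed HF.
have HP0 (al : 'X_{1..n}) : exists P : 'I_n -> S, mdeg al = d ->
    (forall k, P k \is (d - e).-homog) /\ 'X_[al] = \sum_k P k * F k.
  have [/HF[P HP]|ald] := eqVneq (mdeg al) d; first by exists P.
  by exists (fun=> 0) => /eqP; rewrite (negPf ald).
have [P HP] := choice HP0.
have HA0 (m : 'X_{1..n}) : exists al : 'X_{1..n}, (d <= mdeg m)%N -> (al <= m)%MM /\ mdeg al = d.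
  have [/mnm_sub_degree[al hal]|md] := leqP d (mdeg m); first by exists al.
  by exists m.
have [A HA] := choice HA0.
have [sh Hsh] := choice (fun p : 'X_{1..n} * O => shift_exists p.1 (fun m => A m == p.1) p.2).
pose L a i : O := \sum_(al : 'X_{1..n < d.+1} | mdeg al == d)
  sh ((al : 'X_{1..n}), a) * ps_of_mpoly (P al i).
exists L; split.
- move=> a b i; rewrite /L -sumrB; apply: eq_bigr => al _; rewrite -mulrBl; congr (_ * _).
  apply: convps_eq => m; rewrite pscoefB !(Hsh _).1 /=.
  by case: ifP => _; rewrite ?subr0 ?pscoefB.
- move=> k a i dk ak; apply: ord_ge_sum => al /eqP ald.
  have -> : (k - e = (k - d) + (d - e))%N by lia.
  apply: ord_geM; last exact/ord_ge_of_mpoly/(HP _ ald).1.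
  move=> m mk; rewrite (Hsh _).1 /=; case: ifP => // _; apply: ak.
  by rewrite mdegD ald; lia.
- pose c (al : 'X_{1..n < d.+1}) i := \sum_(m <- msupp (P al i)) `|(P al i)@_m|.
  have c0 al i : 0 <= c al i by apply: sumr_ge0.
  exists (\sum_(al : 'X_{1..n < d.+1} | mdeg al == d) \sum_i c al i); split.
    by apply: sumr_ge0 => al _; apply: sumr_ge0.
  move=> r M a i r0 ha; have M0 := norm_le_ge0 ha.
  rewrite mulr_suml; apply: norm_le_sum => [|al /eqP ald]; first exact: ltW.
  have h1 := (Hsh ((al : 'X_{1..n}), a)).2 r M r0 ha.
  have h2 := norm_le_of_mpoly (ltW r0) ((HP _ ald).1 i).
  apply: norm_leW (norm_leM (ltW r0) h1 h2); rewrite /= ald -/(c al i).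
  (* Homogeneity of the quotients combines r^-d and r^(d-e) into r^-e, with a constant independent
     of r. *)
  have -> : M / r ^+ d * (c al i * r ^+ (d - e)) = c al i * (M / r ^+ e).
    rewrite -{1}(subnK ed) exprD.
    have rn : r != 0 by rewrite gt_eqF.
    by field; rewrite !expf_neq0.
  apply: ler_wpM2r; first by rewrite mulr_ge0 // invr_ge0 exprn_ge0 // ltW.
  by rewrite (bigD1 i) //= lerDl sumr_ge0.
move=> a ad.
transitivity (\sum_(al : 'X_{1..n < d.+1} | mdeg al == d)
    sh ((al : 'X_{1..n}), a) * ps_of_mpoly 'X_[al]).
  rewrite /L; under eq_bigr do rewrite mulr_suml.
  rewrite exchange_big /=; apply: eq_bigr => al /eqP ald.
  rewrite (HP _ ald).2 rmorph_sum mulr_sumr; apply: eq_bigr => i _.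
  by rewrite rmorphM mulrA.
apply: convps_eq => m.
have pscoef_sum (J : finType) (Q : pred J) (G : J -> O) :
    pscoef (\sum_(j | Q j) G j) m = \sum_(j | Q j) pscoef (G j) m.
  by apply: (big_morph (fun x : O => pscoef x m)).
rewrite pscoef_sum; under eq_bigr do rewrite pscoef_mulX.
have [dm|md] := leqP d (mdeg m); last first.
  rewrite big1 ?ad // => al /eqP ald; case: ifP => // alm.
  by have := md; rewrite -(submK alm) mdegD ald ltnNge leq_addl.
have [Am Ad] := HA m dm.
have Ab : (mdeg (A m) < d.+1)%N by rewrite Ad.
(* Only al = [A m] contributes to the coefficient of m; the selector rejects m for every other
   al. *)
rewrite (bigD1 (BMultinom Ab)) /= ?Ad //= Am (Hsh _).1 /= submK // eqxx big1 ?addr0 // => al.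
case/andP=> _ alA; case: ifP => // alm; rewrite (Hsh _).1 /= submK //.
by rewrite bmeqP eq_sym in alA; rewrite (negPf alA).
Qed.

End Division.

Section Solve.
Variables (K : numFieldType) (n : nat).
Local Notation O := (convps K n).
Local Notation S := {mpoly K[n]}.

(* xi is a fixed point of xi |-> L (g - f - Q xi), where Q is the Taylor remainder of f
   and L divides by the partial derivatives. Both L o Q raising orders and its being
   quadratically small on a ball of radius eps * r come from the homogeneity of f. *)
Lemma coordinate_change_exists (e d : nat) (f : S) (g : O) : f \is e.+1.-homog -> (e + 2 <= d)%N ->
  (forall al : 'X_{1..n}, mdeg al = d -> exists P : 'I_n -> S,
     (forall k, P k \is (d - e).-homog) /\ 'X_[al] = \sum_k P k * f^`M(k)) ->
  ord_ge d (g - ps_of_mpoly f) ->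
  exists2 xi : 'I_n -> O, (forall i, ord_ge 2 (xi i)) &
    ps_eval (fun i => psX K i + xi i) f = g.
Proof.
move=> hf ed HF; set h := g - _ => hd.
have k2 : (2 <= d - e)%N by lia.
have dk : d.+1 = (d - e + e.+1)%N by lia.
have kS l : (l < maxn l (d - e) + e.+1 - e)%N by lia.
have dl l : (d <= maxn l (d - e) + e.+1)%N by lia.
have [|L [LB Lord [C [C0 Lnorm]] Leq]] := division_operator _ HF; first by lia.
pose k := (d - e)%N.
pose T (xi : 'I_n -> O) i := L (h - taylor_rem xi f) i.
have tord (xi : 'I_n -> O) : (forall i, ord_ge k (xi i)) -> ord_ge d.+1 (taylor_rem xi f).
  (* The zero shift has zero remainder, so the difference estimate gives order (d - e) + (e + 1). *)
  move=> hxi; rewrite -[taylor_rem xi f]subr0 -(taylor_rem0 f).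
  rewrite dk; apply: ord_ge_taylor_remB => // i; rewrite ?subr0 //.
  by apply: ord_geW k2 (hxi i).
pose c := \sum_(m <- msupp f) `|f@_m|; have c0 : 0 <= c by apply: sumr_ge0.
have [r0 [M [r0_gt0 hM]]] := convps_norm_le h; have M0 := norm_le_ge0 hM.
(* The radius eps r of the ball is split in halves. This eps confines the contribution of the
   remainder to one half, for every r by homogeneity. *)
have [eps [eps_gt0 [eps_le1 Heps]]] : exists eps : K, 0 < eps /\ (eps <= 1 /\
    C * (c * 2%:R ^+ e.+1) * eps <= 2%:R^-1).
  set X := C * _; have X0 : 0 <= X by rewrite !mulr_ge0 // exprn_ge0.
  have s0 : 0 < 1 + 2%:R * X by rewrite ltr_pwDl // mulr_ge0.
  exists (1 + 2%:R * X)^-1; rewrite invr_gt0 s0 invf_le1 // lerDl mulr_ge0 //.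
  do 2!split=> //; rewrite ler_pdivrMr // mulrDr mulr1 mulKf ?pnatr_eq0 //.
  by rewrite lerDr invr_ge0.
(* The other half is for L h: as h has order d >= e + 2, its norm decays faster than r^(e+1) when r
   shrinks. *)
have [r [r_gt0 [Mh [hMh HMh]]]] : exists r, 0 < r /\ exists Mh, norm_le r Mh h /\
    C * Mh <= eps / 2%:R * r ^+ e.+1.
  pose W := eps / 2%:R * r0 ^+ e.+1; pose Z := C * M.
  have W0 : 0 < W by rewrite mulr_gt0 ?divr_gt0 ?exprn_gt0.
  have Z0 : 0 <= Z by rewrite mulr_ge0.
  have ZW0 : 0 <= Z / W by rewrite divr_ge0 // ltW.
  have s0 : 0 < 1 + Z / W by rewrite ltr_pwDl.
  pose t := (1 + Z / W)^-1; have t0 : 0 < t by rewrite invr_gt0.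
  have t1 : t <= 1 by rewrite invf_le1 // lerDl.
  exists (t * r0); split; first exact: mulr_gt0.
  exists (t ^+ d * M); split; first exact: norm_le_shrink (ltW r0_gt0) (ltW t0) t1 hd hM.
  apply: (@le_trans _ _ (t ^+ e.+1 * (t * Z))).
    have -> : C * (t ^+ d * M) = t ^+ d * Z by rewrite /Z mulrCA.
    have -> : t ^+ d = t ^+ (d - e.+2) * (t ^+ e.+1 * t).
      by rewrite -exprSr -exprD subnK // -addn2.
    rewrite -!mulrA ler_piMl ?mulr_ge0 ?exprn_ge0 ?(ltW t0) //.
    by rewrite exprn_ile1 // ltW.
  have -> : eps / 2%:R * (t * r0) ^+ e.+1 = t ^+ e.+1 * W.
    by rewrite /W exprMn mulrCA.
  rewrite ler_pM2l ?exprn_gt0 // ler_pdivrMl // mulrDl mul1r divfK ?gt_eqF //.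
  by rewrite lerDr ltW.
have [|||xi Bxi Txi] := @ord_fixpoint K n 'I_n k r (eps * r) T r_gt0 _ _ _.
- by rewrite mulr_ge0 // ltW.
- move=> xi Bxi i; split.
    by apply: Lord => //; apply: ord_geB => //; apply: ord_geW (tord _ (fun j => (Bxi j).1)).
  have ht := norm_le_taylor_rem hf (ltW r_gt0) (ltW eps_gt0) eps_le1 (fun j => (Bxi j).2).
  apply: norm_leW (Lnorm _ _ _ i r_gt0 (norm_leB (ltW r_gt0) hMh ht)).
  rewrite -/c mulrA ler_pdivrMr ?exprn_gt0 // -mulrA -exprS mulrDr.
  have -> : eps * r ^+ e.+1 = eps / 2%:R * r ^+ e.+1 + 2%:R^-1 * (eps * r ^+ e.+1) by field.
  apply: lerD => //.
  have -> : C * (c * ((2%:R * r) ^+ e.+1 * eps ^+ 2)) =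
     C * (c * 2%:R ^+ e.+1) * eps * (eps * r ^+ e.+1) by rewrite exprMn; ring.
  by apply: ler_wpM2r => //; rewrite mulr_ge0 ?exprn_ge0 ?ltW.
- move=> l xi xi' Bxi Bxi' hl i; rewrite /T -LB.
  have -> : h - taylor_rem xi f - (h - taylor_rem xi' f) =
    taylor_rem xi' f - taylor_rem xi f by ring.
  (* Both points have order at least k. Using this for small l keeps the remainders in order at
     least d, where the order estimate of L applies. *)
  have hD j : ord_ge (maxn l k) (xi' j - xi j).
    rewrite /maxn; case: ifP => _; last by apply: ord_geBC.
    by apply: ord_geB; [exact: (Bxi' j).1 | exact: (Bxi j).1].
  have hk (ze : 'I_n -> O) : (forall j, ord_ge k (ze j)) -> forall j, ord_ge 2 (ze j).
    by move=> hz j; apply: ord_geW k2 (hz j).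
  have := ord_ge_taylor_remB hf (hk _ (fun j => (Bxi' j).1)) (hk _ (fun j => (Bxi j).1)) hD.
  by move=> /(Lord _ _ i (dl l)); apply: ord_geW (kS l).
exists xi => [i|]; first by apply: ord_geW k2 (Bxi i).1.
have := Leq (h - taylor_rem xi f).
under eq_bigr do rewrite -/(T xi _) Txi.
move=> E; have {E} E : \sum_i xi i * ps_of_mpoly f^`M(i) = h - taylor_rem xi f.
  by apply: E; apply: ord_geB => //; apply: ord_geW (tord _ (fun j => (Bxi j).1)).
have -> : ps_eval (fun i => psX K i + xi i) f =
    taylor_rem xi f + ps_of_mpoly f + \sum_i xi i * ps_of_mpoly f^`M(i).
  by rewrite /taylor_rem; ring.
by rewrite E /h; ring.
Qed.

End Solve.

Lemma dhomog_mderiv (K : nzRingType) n d (p : {mpoly K[n]}) k :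
  p \is d.+1.-homog -> p^`M(k) \is d.-homog.
Proof.
move=> /dhomogP hp; apply/dhomogP => m; rewrite mcoeff_msupp mcoeff_deriv => pm.
have /hp /= : (m + U_(k))%MM \in msupp p.
  by rewrite mcoeff_msupp; apply: contraNneq pm => ->; rewrite mul0rn.
by rewrite mdegD mdeg1 addn1 => -[].
Qed.

(** * Determinacy of regular forms and the bound on D(n, m) *)

Section Main.
Variables (R : realType) (n m : nat).
Local Notation K := (R[i] : numFieldType).

Lemma ord_ge_ideal_pow k (a : convps K n) : ideal_pow (@maxideal K n) k a -> ord_ge k a.
Proof.
elim: k a => [|k IH] a //= [s Hs ->].
rewrite big_seq; apply: ord_ge_sum => p /Hs[p1 p2]; rewrite -add1n.
apply: ord_geM (IH _ p2) => q; rewrite ltnS leqn0 mdeg_eq0 => /eqP ->; exact: p1.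
Qed.

Lemma regular_form_right_equiv (f : {mpoly R[i][n]}) (g : convps R[i] n) :
  (2 <= n)%N -> (3 <= m)%N -> (n, m) <> (2%N, 3%N) -> regular_form m f ->
  ord_ge (n * (m - 2)).+1 (g - ps_of_mpoly f) -> right_equiv (ps_of_mpoly f) g.
Proof.
move=> hn hm hnm /(regular_formP _ (ltn_trans (ltn0Sn 1) hm))[hf hreg] hg.
have [e def_m] : exists e, m = e.+3 by exists (m - 3)%N; lia.
rewrite def_m in hf hm hnm hg *.
have hdf k : f^`M(k) \is e.+2.-homog by apply: dhomog_mderiv.
have hsocle (al : 'X_{1..n}) : mdeg al = (n * e.+1).+1 -> exists P : 'I_n -> {mpoly R[i][n]},
    (forall k, P k \is ((n * e.+1).+1 - e.+2).-homog) /\ 'X_[al] = \sum_k P k * f^`M(k).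
  move=> alE; rewrite -alE; apply: (forms_socle_bound (@complexI R)) => //.
  by rewrite alE ltnSn.
have [|xi hxi xiE] := coordinate_change_exists hf _ hsocle hg.
  (* The derivatives have degree m - 1 = e + 2, so the condition is e + 4 <= n(e + 1) + 1. It always
     holds for n >= 3, and for n = 2 exactly when e > 0, that is m > 3. *)
  have : (n = 2 -> e <> 0)%N by move=> nE eE; apply: hnm; rewrite nE eE.
  by move: hn; clear; nia.
have [phi phi_bij hphi] := tangent_identity_automorphism hxi.
exists phi => //; rewrite -xiE; apply: subst_of_mpoly (hphi _); exact: shifted_ord1.
Qed.

End Main.

Theorem theorem3p1 (R : realType) (n m : nat)
    (hn : (2 <= n)%N) (hm : (3 <= m)%N) (hnm : (n, m) <> (2%N, 3%N)) :
  (forall f : {mpoly R[i][n]}, regular_form m f ->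
     determined (n * (m - 2))%N (ps_of_mpoly f)) /\
  (exists D : nat,
     is_Dnm R[i] n m D /\
     (D <= n * (m - 2) + 1)%N /\
     ((n, m) = (3%N, 3%N) \/ (n, m) = (2%N, 4%N) -> D = (m + 1)%N)).
Proof.
have main f g := @regular_form_right_equiv R n m f g hn hm hnm.
split=> [f hf g /ord_ge_ideal_pow|]; first exact: main.
have hD : determines_germs R[i] n m (n * (m - 2) + 1).
  (* The inequality m < n(m-2) + 1 would fail for (2,3), where both sides equal 3. *)
  split; first by move: hnm; clear -hn hm => hnm; have : (n = 2 -> m <> 3)%N; [by move=> nE mE; apply: hnm; rewrite nE mE | nia].
  move=> f hf d hd g /ord_ge_ideal_pow gd.
  have [|phi phi_bij phiE] := main f g hf; first by apply: ord_geW gd; rewrite -addn1.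
  by exists phi => //; exists 1; rewrite ?unitr1 ?mul1r.
pose P D := `[< determines_germs R[i] n m D >].
have exP : exists D, P D by exists (n * (m - 2) + 1)%N; apply/asboolP.
exists (ex_minn exP); case: ex_minnP => D /asboolP PD Dmin.
have Dle : (D <= n * (m - 2) + 1)%N by apply: Dmin; apply/asboolP.
split; first by split=> // D' /asboolP; apply: Dmin.
split=> //; have [mD _] := PD.
(* In both cases n(m-2) + 1 = m + 1, the least value compatible with D > m. *)
by case=> -[nE mE]; move: Dle mD; rewrite nE mE; clear; lia.
Qed.
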